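(* Let $p,q\in[1,\infty)$ and let $X$ be a finite-dimensional complex Banach space with $R_{p,q}(X)>0$. Then $$\lim_{n\to\infty}R^n_{p,q}(X)\sqrt{\frac{n}{\log n}}=1.$$
   Context: For a complex Banach space $X$ and a holomorphic $f:\mathbb D^n\to X$ ($\mathbb D^n$ the open unit polydisk), $f(z)=x_0+\sum_{|\alpha|\ge1}x_\alpha z^\alpha$ (multi-index notation), with $\sup_{z\in\mathbb D^n}\|f(z)\|\le1$, define $R^n_{p,q}(f,X)=\sup\{r\ge0: \|x_0\|^p+(\sum_{k\ge1}\sum_{|\alpha|=k}\|x_\alpha z^\alpha\|)^q\le1\ \forall z\in r\mathbb D^n\}$, $R^n_{p,q}(X)=\inf$ of $R^n_{p,q}(f,X)$ over all such $f$, and $R_{p,q}(X)=R^1_{p,q}(X)$. *)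

(* Defs.v *)
(* Complex numbers are R[i] (real_closed's
   complex) over an arbitrary R : realType; the finite-dimensional complex
   Banach space X is modelled as 'rV[R[i]]_d equipped with a norm N. *)
From mathcomp Require Import all_boot all_order all_algebra.
From mathcomp Require Import all_classical all_reals all_analysis.
From mathcomp Require Import complex.

Set Implicit Arguments.
Unset Strict Implicit.
Unset Printing Implicit Defensive.

Import Order.TTheory GRing.Theory Num.Theory.
Import numFieldNormedType.Exports.
Local Open Scope classical_set_scope.
Local Open Scope ring_scope.

Notation normc := Normc.normc.

(* N is a norm on the complex vector space 'rV[R[i]]_d (finite-dimensional,
   hence automatically complete: a finite-dimensional complex Banach space). *)
Definition is_cnorm (R : realType) (d : nat) (N : 'rV[R[i]]_d -> R) : Prop :=
  [/\ forall x, N x = 0 -> x = 0,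
      forall x y, N (x + y) <= N x + N y &
      forall (a : R[i]) x, N (a *: x) = normc a * N x].

Definition mdeg (n : nat) (a : n.-tuple nat) : nat := (\sum_(i < n) tnth a i)%N.
Definition mzero (n : nat) : n.-tuple nat := [tuple 0%N | _ < n].

Definition cmonom (R : realType) (n : nat) (a : n.-tuple nat)
  (z : 'I_n -> R[i]) : R[i] := \prod_(i < n) z i ^+ tnth a i.

Definition in_polydisk (R : realType) (n : nat) (r : R) (z : 'I_n -> R[i]) : Prop :=
  forall i, normc (z i) < r.

Definition tuple_of_ffun (n K : nat) (b : {ffun 'I_n -> 'I_K}) : n.-tuple nat :=
  [tuple (b i : nat) | i < n].

Definition psum (R : realType) (d n : nat) (c : n.-tuple nat -> 'rV[R[i]]_d)
  (z : 'I_n -> R[i]) (K : nat) : 'rV[R[i]]_d :=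
  \sum_(b : {ffun 'I_n -> 'I_K.+1} | (\sum_(i < n) (b i : nat) <= K)%N)
     cmonom (tuple_of_ffun b) z *: c (tuple_of_ffun b).

(* c is the coefficient family of a holomorphic f : D^n -> X with
   sup_{z in D^n} ||f(z)|| <= 1: the Taylor series converges absolutely on
   D^n, and its sum f(z) has norm <= 1 there. *)
Definition bounded_holo (R : realType) (d n : nat) (N : 'rV[R[i]]_d -> R)
  (c : n.-tuple nat -> 'rV[R[i]]_d) : Prop :=
  (forall z, in_polydisk 1 z ->
     (\esum_(a in [set: n.-tuple nat]) (N (cmonom a z *: c a))%:E < +oo)%E) /\
  (forall z, in_polydisk 1 z ->
     exists v, (fun K => N (psum c z K - v)) @ \oo --> 0 /\ N v <= 1).

Definition BohrR_f (R : realType) (d n : nat) (p q : R) (N : 'rV[R[i]]_d -> R)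
  (c : n.-tuple nat -> 'rV[R[i]]_d) : \bar R :=
  ereal_sup [set r%:E | r in [set r : R | 0 <= r /\
     forall z, in_polydisk r z ->
       ((N (c (mzero n)) `^ p)%:E
        + (\esum_(a in [set a : n.-tuple nat | (0 < mdeg a)%N])
              (N (cmonom a z *: c a))%:E) `^ q <= 1)%E]].

Definition BohrR (R : realType) (d : nat) (p q : R) (N : 'rV[R[i]]_d -> R)
  (n : nat) : \bar R :=
  ereal_inf [set BohrR_f p q N c | c in [set c : n.-tuple nat -> 'rV[R[i]]_d |
                                          bounded_holo N c]].

(* Main.v *)
(* Upper bound.  Put r = rho sqrt(log n / n) with rho > 1 and take
   P(z) = sum_S +-r^|S| z^S over the nonempty sets S of variables.  P is affine
   in each variable, so its supremum over a slightly smaller polydisk is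
   controlled by a product net with exp(O(n)) points, and suitable signs give
   |P| <= C sqrt(n V) with V = (1 + r^2)^n.  At radius r the sum of the moduli
   is V - 1, which is larger because V is about n^(rho^2).

   Lower bound.  Averaging f(w^j t z) over the m-th roots of unity w^j makes the
   homogeneous part P_m of f the first Taylor coefficient of a one-variable
   function, so R_{p,q}(X) > 0 bounds every P_m by a multiple of
   (1 - |x_0|^p)^(1/q).  It remains to see that sum_m |P_m|_1 r^m tends to 0
   uniformly for scalar m-homogeneous P_m bounded by 1 and
   r = s^4 sqrt(log n / n), s < 1.  For fixed k, write |P_m|_1 in terms of the
   k-th order partial derivatives; Cauchy-Schwarz with weights (r / s^2)^|alpha|
   costs about n^(s^4/2), the passage from L^2 to L^(2k/(k+1)) costs 2^(m/k) by
   interpolation with L^4, and the Bohnenblust-Hille inequality for k-linear forms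
   gives n^((k-1)/2).  Together with r^k this is n^((s^4-1)/2), up to powers of
   log n and factors summable over m once k is large.  Means over the torus are
   replaced throughout by means over roots of unity of large order. *)
Require Import Defs.
From mathcomp Require Import all_boot all_order all_algebra.
From mathcomp Require Import all_classical all_reals all_analysis.
From mathcomp Require Import complex.
From mathcomp Require cyclic separable cyclotomic mpoly.
From mathcomp Require Import ring lra zify.
Import Order.TTheory GRing.Theory Num.Theory.
Import numFieldNormedType.Exports.
Import (coercions, canonicals) mpoly.
Local Open Scope classical_set_scope.
Local Open Scope ring_scope.

Set Implicit Arguments.
Unset Strict Implicit.

(** * Finite-sum inequalities and Blei's inequality *)

(** The number k of derivatives stays fixed because the loss of the argument must be summable in the
    degree m: for fixed k the forms have k indices, the constant of their inequality does not grow
    with m, and Cauchy's estimates cost only a power of m. The four powers of s in the radius have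
    separate tasks. Two of them keep the Cauchy-Schwarz weights below n^(1/2); of the two others,
    one per degree pays for 2^(m/k) and one makes the series over m geometric. In the coefficient
    estimates the space X enters through the equivalence of its norm with the coordinates, hence
    through constants free of n, which any negative power of n absorbs. Every bound carries the
    factor A = (1 - |x_0|^p)^(1/q), so it is enough to bring the sum below A, whose q-th power is
    exactly the room that |x_0|^p leaves. For the upper bound, passing from the polydisk to a net
    must not cost a factor per variable, which would be exponential in n. It costs none, because an
    affine function of one variable is compared with its maximum on the unit circle; the price is a
    fixed shrinking of the polydisk, repaired by rescaling. *)

Section RealSums.
Variable R : realType.
Implicit Types (w v : R).

Lemma ler_powR2 (r x y : R) : 0 <= r -> 0 <= x -> x <= y -> x `^ r <= y `^ r.
Proof.
by move=> r0 x0 xy; apply: ge0_ler_powR => //; rewrite nnegrE // (le_trans x0).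
Qed.

Lemma weighted_amgm w v (x y : R) : 0 < w -> 0 < v -> w + v = 1 ->
  0 <= x -> 0 <= y -> x `^ w * y `^ v <= w * x + v * y.
Proof.
move=> w0 v0 wv x0 y0.
have := @conjugate_powR R (x `^ w) (y `^ v) w^-1 v^-1 (powR_ge0 _ _) (powR_ge0 _ _).
rewrite !invr_gt0 !invrK -!powRrM !divff ?gt_eqF // !powRr1 //.
by move=> /(_ w0 v0 wv); rewrite [x * w]mulrC [y * v]mulrC.
Qed.

(** After division by F and G each term falls to the weighted AM-GM inequality; F = 0 and G = 0 are
    set apart because of the division. The exponents are weights with w + v = 1, the form in which
    moments are interpolated below. *)
Lemma hoelder_sum w v (I : Type) (s : seq I) (f g : I -> R) :
  0 < w -> 0 < v -> w + v = 1 ->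
  (forall i, 0 <= f i) -> (forall i, 0 <= g i) ->
  \sum_(i <- s) f i `^ w * g i `^ v <=
  (\sum_(i <- s) f i) `^ w * (\sum_(i <- s) g i) `^ v.
Proof.
move=> w0 v0 wv f0 g0.
set F := \sum_(i <- s) f i; set G := \sum_(i <- s) g i.
have F0 : 0 <= F by apply: sumr_ge0.
have G0 : 0 <= G by apply: sumr_ge0.
have zero (h : I -> R) (u : R) : 0 < u -> (forall i, 0 <= h i) ->
  \sum_(i <- s) h i = 0 -> all (fun i => h i `^ u == 0) s.
  move=> u0 h0; elim: (s) => // i r IH; rewrite big_cons => /eqP.
  have r0 : 0 <= \sum_(j <- r) h j by apply: sumr_ge0.
  rewrite (paddr_eq0 (h0 i) r0) /= => /andP[/eqP -> /eqP /IH ->].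
  by rewrite powR0 ?eqxx // gt_eqF.
have allsum0 (k : I -> R) : all (fun i => k i == 0) s -> \sum_(i <- s) k i = 0.
  elim: (s) => [|i r IH] /=; first by rewrite big_nil.
  by move=> /andP[/eqP i0 /IH r0]; rewrite big_cons i0 r0 addr0.
have [Fz|Fnz] := eqVneq F 0.
  rewrite allsum0 ?mulr_ge0 ?powR_ge0 //.
  by apply: sub_all (zero _ _ w0 f0 Fz) => i /= /eqP ->; rewrite mul0r.
have [Gz|Gnz] := eqVneq G 0.
  rewrite allsum0 ?mulr_ge0 ?powR_ge0 //.
  by apply: sub_all (zero _ _ v0 g0 Gz) => i /= /eqP ->; rewrite mulr0.
have Fp : 0 < F by rewrite lt_def Fnz.
have Gp : 0 < G by rewrite lt_def Gnz.
have powRV1 (x u : R) : 0 <= x -> x^-1 `^ u = (x `^ u)^-1.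
  by move=> x0; rewrite -(powR_inv1 x0) -powRrM mulN1r powRN.
rewrite -[leRHS]mulr1 -ler_pdivrMl ?mulr_gt0 ?powR_gt0 // big_distrr /=.
apply: (@le_trans _ _ (\sum_(i <- s) (w * (f i / F) + v * (g i / G)))).
  apply: ler_sum => i _.
  apply: le_trans (weighted_amgm w0 v0 wv _ _); last 2 first.
  - by rewrite divr_ge0.
  - by rewrite divr_ge0.
  rewrite !powRM ?invr_ge0 // !powRV1 //.
  by rewrite invfM mulrACA [_^-1 * f i `^ _]mulrC [_^-1 * g i `^ _]mulrC.
rewrite big_split /= -!big_distrr /= -!big_distrl /= -/F -/G !divff //.
by rewrite !mulr1 wv.
Qed.

Lemma cauchy_schwarz_sum (I : Type) (s : seq I) (f g : I -> R) :
  (\sum_(i <- s) f i * g i) ^+ 2 <=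
  (\sum_(i <- s) f i ^+ 2) * (\sum_(i <- s) g i ^+ 2).
Proof.
elim: s => [|i s IH]; first by rewrite !big_nil expr0n mul0r.
rewrite !big_cons; move: IH.
set A := \sum_(i <- s) _; set F := \sum_(i <- s) _; set G := \sum_(i <- s) _.
set a := f i; set b := g i => IH.
have F0 : 0 <= F by apply: sumr_ge0 => j _; exact: sqr_ge0.
have G0 : 0 <= G by apply: sumr_ge0 => j _; exact: sqr_ge0.
have key : 2 * A * (a * b) <= F * b ^+ 2 + G * a ^+ 2.
  apply: le_trans (ler_norm _) _.
  rewrite -(ler_pXn2r (n:=2)) ?nnegrE //; last first.
    by rewrite addr_ge0 // mulr_ge0 ?sqr_ge0.
  rewrite real_normK ?num_real //.
  apply: (@le_trans _ _ (4 * (F * G) * (a * b) ^+ 2)).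
    have -> : (2 * A * (a * b)) ^+ 2 = 4 * A ^+ 2 * (a * b) ^+ 2 by ring.
    by rewrite ler_wpM2r ?sqr_ge0 // ler_wpM2l.
  rewrite -subr_ge0.
  have -> : (F * b ^+ 2 + G * a ^+ 2) ^+ 2 - 4 * (F * G) * (a * b) ^+ 2 =
     (F * b ^+ 2 - G * a ^+ 2) ^+ 2 by ring.
  exact: sqr_ge0.
have -> : (a * b + A) ^+ 2 = A ^+ 2 + 2 * A * (a * b) + a ^+ 2 * b ^+ 2 by ring.
have -> : (a ^+ 2 + F) * (b ^+ 2 + G) =
  F * G + (F * b ^+ 2 + G * a ^+ 2) + a ^+ 2 * b ^+ 2 by ring.
by rewrite lerD2r lerD.
Qed.

Definition l2norm (I : Type) (s : seq I) (f : I -> R) : R :=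
  Num.sqrt (\sum_(i <- s) f i ^+ 2).

Lemma l2norm_ge0 (I : Type) (s : seq I) (f : I -> R) : 0 <= l2norm s f.
Proof. exact: sqrtr_ge0. Qed.

Lemma sqr_l2norm (I : Type) (s : seq I) (f : I -> R) :
  l2norm s f ^+ 2 = \sum_(i <- s) f i ^+ 2.
Proof. by rewrite sqr_sqrtr // sumr_ge0 // => i _; exact: sqr_ge0. Qed.

Lemma l2norm_triangle (I : Type) (s : seq I) (f g : I -> R) :
  l2norm s (fun i => f i + g i) <= l2norm s f + l2norm s g.
Proof.
rewrite -(ler_pXn2r (n:=2)) ?nnegrE ?addr_ge0 ?l2norm_ge0 //.
rewrite sqr_l2norm sqrrD !sqr_l2norm.
under eq_bigr => i _ do rewrite sqrrD.
rewrite !big_split /= lerD2r lerD2l -mulr2n lerMn2r /=.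
apply: le_trans (ler_norm _) _.
rewrite -(ler_pXn2r (n:=2)) ?nnegrE ?mulr_ge0 ?l2norm_ge0 //.
rewrite real_normK ?num_real // exprMn !sqr_l2norm.
exact: cauchy_schwarz_sum.
Qed.

Lemma l2norm_sum (I J : Type) (s : seq I) (t : seq J) (f : J -> I -> R) :
  l2norm s (fun i => \sum_(j <- t) f j i) <= \sum_(j <- t) l2norm s (f j).
Proof.
elim: t => [|j t IH].
  rewrite /l2norm big_nil big1 ?sqrtr0 // => i _.
  by rewrite big_nil expr0n.
rewrite big_cons; apply: le_trans (lerD (lexx _) IH).
apply: le_trans (l2norm_triangle _ _ _).
by rewrite /l2norm; under eq_bigr => i _ do rewrite big_cons.
Qed.

Lemma l2normZ (I : Type) (s : seq I) (c : R) (f : I -> R) : 0 <= c ->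
  l2norm s (fun i => c * f i) = c * l2norm s f.
Proof.
move=> c0; rewrite /l2norm; under eq_bigr => i _ do rewrite exprMn.
by rewrite -big_distrr /= sqrtrM ?sqr_ge0 // sqrtr_sqr ger0_norm.
Qed.

(** [F] takes lists, so prepending an index needs no cast between tuple lengths. Coefficients of
    forms and iterated derivatives are indexed by lists for the same reason. *)
Lemma big_tuple_cons (T : finType) (k : nat) (F : seq T -> R) :
  \sum_(t : k.+1.-tuple T) F t =
  \sum_(j : T) \sum_(t : k.-tuple T) F (j :: t).
Proof.
rewrite pair_big /=.
rewrite (reindex (fun p : T * k.-tuple T => [tuple of p.1 :: p.2])) //=.
exists (fun t => (thead t, [tuple of behead t])) => /=.
  by move=> [j t] _; congr pair; apply: val_inj.
by move=> t _; rewrite [RHS]tuple_eta; apply: val_inj.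
Qed.

Lemma big_tuple_nil (T : finType) (F : seq T -> R) :
  \sum_(t : 0.-tuple T) F t = F [::].
Proof.
rewrite (big_pred1 [tuple]) //= => t.
by apply/esym/eqP; apply: val_inj; rewrite /= tuple0.
Qed.

(* Interpolating between the exponents 2k/(k+1) and 2 in the inner variables
   and then using Hoelder in the outer one; symmetry turns Minkowski's
   inequality for the first two variables into a bound by the same norm. *)
Lemma blei_symmetric (T : finType) (k : nat) (a : seq T -> R) :
  (forall s, 0 <= a s) -> (forall s t, perm_eq s t -> a s = a t) ->
  \sum_(t : k.+1.-tuple T) a t `^ (2 * k.+1%:R / k.+2%:R) <=
  (\sum_(j : T) l2norm (index_enum {: k.-tuple T}) (fun t => a (j :: t)))
     `^ (2 * k.+1%:R / k.+2%:R).
Proof.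
elim: k a => [|k IH] a a0 asym.
  rewrite mulr1 divff // [leRHS]powRr1; last first.
    by apply: sumr_ge0 => j _; exact: l2norm_ge0.
  rewrite (big_tuple_cons 0 (fun s => a s `^ 1)); apply: ler_sum => j _.
  rewrite (big_tuple_nil (fun s => a (j :: s) `^ 1)) powRr1 //.
  rewrite /l2norm (big_tuple_nil (fun s => a (j :: s) ^+ 2)).
  by rewrite sqrtr_sqr ger0_norm.
set L := fun (j : T) => l2norm (index_enum {: k.+1.-tuple T}) (fun t => a (j :: t)).
set A := fun (j : T) => \sum_(i : T)
  l2norm (index_enum {: k.-tuple T}) (fun t => a (j :: i :: t)).
set N := (X in _ <= X `^ _).
have A0 j : 0 <= A j by apply: sumr_ge0 => i _; exact: l2norm_ge0.
have L0 j : 0 <= L j by exact: l2norm_ge0.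
have N0 : 0 <= N by apply: sumr_ge0 => j _; exact: L0.
have k3 : k.+3%:R != 0 :> R by rewrite pnatr_eq0.
have k2 : k.+2%:R != 0 :> R by rewrite pnatr_eq0.
rewrite (big_tuple_cons k.+1 (fun s => a s `^ _)).
(* 2(k+2)/(k+3) is the mean of 2(k+1)/(k+2) and 2 with weights (k+2)/(k+3) and 1/(k+3). The first
   factor falls to the induction hypothesis for the array with first index j. *)
have step j : \sum_(t : k.+1.-tuple T) a (j :: t) `^ (2 * k.+2%:R / k.+3%:R) <=
   (A j ^+ 2) `^ (k.+1%:R / k.+3%:R) * L j `^ (2 / k.+3%:R).
  apply: (@le_trans _ _
    (\sum_(t : k.+1.-tuple T) (a (j :: t) `^ (2 * k.+1%:R / k.+2%:R)) `^ (k.+2%:R / k.+3%:R)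
        * (a (j :: t) ^+ 2) `^ k.+3%:R^-1)).
    apply: ler_sum => t _.
    rewrite -powRrM -powR_mulrn // -powRrM -powRD; last first.
      by rewrite implybE gt_eqF // addr_gt0 // ?mulr_gt0 ?divr_gt0 ?invr_gt0 ?ltr0n.
    rewrite le_eqVlt; apply/orP; left; apply/eqP; congr (_ `^ _).
    have -> : k.+2%:R = k.+1%:R + 1 :> R by rewrite natr1.
    have : k.+1%:R + 1 != 0 :> R by rewrite natr1.
    by move: k3 => *; field; apply/andP.
  have w0 : 0 < k.+2%:R / k.+3%:R :> R by rewrite divr_gt0 ?ltr0n.
  have v0 : 0 < k.+3%:R^-1 :> R by rewrite invr_gt0 ltr0n.
  have wv : k.+2%:R / k.+3%:R + k.+3%:R^-1 = 1 :> R.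
    by rewrite -[X in _ + X]mul1r -mulrDl natr1 divff.
  apply: le_trans (hoelder_sum _ w0 v0 wv _ _) _.
  - by move=> t; exact: powR_ge0.
  - by move=> t; exact: sqr_ge0.
  apply: ler_pM; rewrite ?powR_ge0 //.
    apply: le_trans (ler_powR2 (ltW w0) _ (IH (fun s => a (j :: s)) _ _)) _.
    - by apply: sumr_ge0 => t _; exact: powR_ge0.
    - by move=> s.
    - by move=> s t st; apply: asym; rewrite perm_cons.
    rewrite -/(A j) -powR_mulrn // -!powRrM.
    rewrite le_eqVlt; apply/orP; left; apply/eqP; congr (_ `^ _).
    by rewrite -!mulrA; congr (_ * (_ * _)); rewrite mulrA mulVf // mul1r.
  rewrite -sqr_l2norm -/(L j) -powR_mulrn // -powRrM //.
apply: le_trans (ler_sum _ _) _; first by move=> j _; exact: step.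
have w0 : 0 < k.+1%:R / k.+3%:R :> R by rewrite divr_gt0 ?ltr0n.
have v0 : 0 < 2 / k.+3%:R :> R by rewrite divr_gt0 ?ltr0n.
have wv : k.+1%:R / k.+3%:R + 2 / k.+3%:R = 1 :> R.
  by rewrite -mulrDl -natrD addn2 divff.
apply: le_trans (hoelder_sum _ w0 v0 wv _ _) _.
- by move=> j; exact: sqr_ge0.
- by [].
have -> : 2 * k.+2%:R / k.+3%:R = 2 * (k.+1%:R / k.+3%:R) + 2 / k.+3%:R :> R.
  by have -> : k.+2%:R = k.+1%:R + 1 :> R; [rewrite natr1|field].
rewrite powRD; last by rewrite implybE gt_eqF // addr_gt0 // mulr_gt0.
apply: ler_wpM2r; first exact: powR_ge0.
rewrite [leRHS]powRrM powR_mulrn //.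
apply: ler_powR2 (ltW w0) _ _; first by apply: sumr_ge0 => j _; exact: sqr_ge0.
rewrite -sqr_l2norm ler_pXn2r ?nnegrE ?l2norm_ge0 //.
apply: le_trans (l2norm_sum _ _ _) _.
apply: ler_sum => i _.
rewrite [leRHS]/l2norm (big_tuple_cons k (fun s => a (i :: s) ^+ 2)).
rewrite [leLHS]/l2norm; apply: ler_wsqrtr; apply: ler_sum => j _.
rewrite sqr_l2norm; apply: ler_sum => t _.
by rewrite (asym (j :: i :: t) (i :: j :: t)) // (perm_catCA [:: j] [:: i]).
Qed.

End RealSums.

(** * Means over roots of unity *)

Section ComplexModulus.
Variable R : realType.
Implicit Types x y : R[i].

Lemma normcR x : (normc x)%:C%C = `|x|.
Proof. by rewrite normc_def; case: x. Qed.

Lemma RtoC_inj : injective (real_complex R).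
Proof. by move=> a b []. Qed.

Lemma RtoCM (a b : R) : (a * b)%:C%C = a%:C%C * b%:C%C :> R[i].
Proof. exact: rmorphM. Qed.

Lemma RtoC_nat k : (k%:R : R)%:C%C = k%:R :> R[i].
Proof. exact: rmorph_nat. Qed.

Lemma RtoC_sum (I : Type) (s : seq I) (F : I -> R) :
  (\sum_(i <- s) F i)%:C%C = \sum_(i <- s) (F i)%:C%C :> R[i].
Proof. exact: rmorph_sum. Qed.

Lemma conjcM x y : (x * y)^*%C = x^*%C * y^*%C.
Proof. exact: rmorphM. Qed.

Lemma normc_ge0 x : 0 <= normc x.
Proof. by case: x => a b; exact: sqrtr_ge0. Qed.

Lemma normcD_le x y : normc (x + y) <= normc x + normc y.
Proof. exact: le_normcD. Qed.

Lemma normc_opp x : normc (- x) = normc x.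
Proof. exact: normcN. Qed.

Lemma normcX x k : normc (x ^+ k) = normc x ^+ k.
Proof.
elim: k => [|k IH]; first by rewrite !expr0 Normc.normc1.
by rewrite !exprS Normc.normcM IH.
Qed.

Lemma normc_prod (I : Type) (s : seq I) (F : I -> R[i]) :
  normc (\prod_(i <- s) F i) = \prod_(i <- s) normc (F i).
Proof.
elim: s => [|i s IH]; first by rewrite !big_nil Normc.normc1.
by rewrite !big_cons Normc.normcM IH.
Qed.

Lemma normc_sum (I : Type) (s : seq I) (P : pred I) (F : I -> R[i]) :
  normc (\sum_(i <- s | P i) F i) <= \sum_(i <- s | P i) normc (F i).
Proof.
elim: s => [|i s IH]; first by rewrite !big_nil Normc.normc0.
rewrite !big_cons; case: ifP => // _.
by apply: le_trans (normcD_le _ _) _; rewrite lerD2l.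
Qed.

Lemma normc_sqrC x : ((normc x) ^+ 2)%:C%C = x * x^*%C.
Proof. by rewrite rmorphXn /= normcR sqr_normc. Qed.

Lemma normc_conj x : normc x^*%C = normc x.
Proof. by case: x => a b /=; rewrite sqrrN. Qed.

Lemma normc_real (r : R) : normc r%:C%C = `|r|.
Proof. by rewrite /= expr0n addr0 sqrtr_sqr. Qed.

Lemma normc_nat k : normc (k%:R : R[i]) = k%:R.
Proof. by rewrite -(rmorph_nat (real_complex R)) normc_real ger0_norm. Qed.

Lemma normc_unity_root x M : (0 < M)%N -> x ^+ M = 1 -> normc x = 1.
Proof.
move=> M0 xM; have /eqP := congr1 (@normc R) xM.
by rewrite normcX Normc.normc1 pexpr_eq1 ?normc_ge0 // => /eqP.
Qed.

(** Purely algebraic: 'X^M - 1 splits over the closed field R[i], its roots are distinct in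
    characteristic 0, and M distinct M-th roots of unity include a primitive one. *)
Lemma exists_prim_root M : (0 < M)%N -> {w : R[i] | M.-primitive_root w}.
Proof.
pose p : {poly R[i]} := 'X^M - 1; have [r Dp] := closed_field_poly_normal p.
move=> M0; apply/sigW; rewrite (monicP _) ?monicXnsubC // scale1r in Dp.
have rn1 : all M.-unity_root r by apply/allP=> z; rewrite -root_prod_XsubC -Dp.
have sz_r : (M < (size r).+1)%N.
  by rewrite -(size_prod_XsubC r id) -Dp size_XnsubC.
have [|z] := hasP (cyclic.has_prim_root M0 rn1 _ sz_r); last by exists z.
by rewrite -separable.separable_prod_XsubC -Dp cyclotomic.separable_Xn_sub_1 // pnatr_eq0 -lt0n.
Qed.

End ComplexModulus.

Section TorusMean.
Variables (R : realType) (n M : nat) (w : R[i]).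
Hypothesis M0 : (0 < M)%N.
Hypothesis wprim : M.-primitive_root w.

Definition torus_pt (x : {ffun 'I_n -> 'I_M}) : 'I_n -> R[i] := fun i => w ^+ x i.

(** Exact in place of the integral over the torus for products of z^a with the conjugate of z^b when
    all exponents are below M; each use takes M beyond the degrees that occur. *)
Definition torus_mean (f : ('I_n -> R[i]) -> R) : R :=
  #|{ffun 'I_n -> 'I_M}|%:R^-1 * \sum_x f (torus_pt x).

Lemma normc_torus_pt x i : normc (torus_pt x i) = 1.
Proof.
by apply: (@normc_unity_root _ _ M M0); rewrite ?/torus_pt exprAC (prim_expr_order wprim) expr1n.
Qed.

Lemma torus_card_gt0 : 0 < #|{ffun 'I_n -> 'I_M}|%:R :> R.
Proof. by rewrite ltr0n card_ffun !card_ord expn_gt0 M0. Qed.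

(** The sum is geometric with ratio u = w^a conj(w^b), and u^M = 1. The bounds a, b < M are what
    makes u = 1 force a = b. *)
Lemma sum_roots_orthogonal (a b : nat) : (a < M)%N -> (b < M)%N ->
  \sum_(j < M) (w ^+ j) ^+ a * ((w ^+ j) ^+ b)^*%C = (M * (a == b))%:R.
Proof.
move=> aM bM.
have wb : w ^+ b * (w ^+ b)^*%C = 1.
  rewrite -normc_sqrC (@normc_unity_root _ _ M) ?expr1n //.
  by rewrite ?/torus_pt exprAC (prim_expr_order wprim) expr1n.
pose u := w ^+ a * (w ^+ b)^*%C.
have -> : \sum_(j < M) (w ^+ j) ^+ a * ((w ^+ j) ^+ b)^*%C = \sum_(j < M) u ^+ j.
  apply: eq_bigr => j _; rewrite exprMn -!exprM ![(j * _)%N]mulnC !exprM.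
  by congr (_ * _); rewrite rmorphXn.
have [ab|ab] := eqVneq a b.
  rewrite muln1; have -> : u = 1 by rewrite /u ab.
  by under eq_bigr => j _ do rewrite expr1n; rewrite sumr_const card_ord.
rewrite muln0; have u1 : u - 1 != 0.
  rewrite subr_eq0; apply: contra ab => /eqP E.
  have : w ^+ a == w ^+ b.
    by apply/eqP; rewrite -[LHS]mulr1 -wb mulrCA -/u E mulr1.
  by rewrite (eq_prim_root_expr wprim) !modn_small.
apply: (mulfI u1); rewrite -subrX1 mulr0; apply/eqP; rewrite subr_eq0; apply/eqP.
rewrite exprMn -rmorphXn /= (exprAC w a) (exprAC w b) (prim_expr_order wprim).
by rewrite !expr1n rmorph1 mulr1.
Qed.

Definition mono (a : mpoly.multinom n) (z : 'I_n -> R[i]) : R[i] :=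
  \prod_(i < n) z i ^+ a i.

Lemma mono_orthogonal (a b : mpoly.multinom n) :
  (forall i, (a i < M)%N) -> (forall i, (b i < M)%N) ->
  \sum_x mono a (torus_pt x) * (mono b (torus_pt x))^*%C =
  (#|{ffun 'I_n -> 'I_M}| * (a == b))%:R.
Proof.
move=> aM bM.
transitivity (\prod_(i < n) \sum_(j < M) (w ^+ j) ^+ a i * ((w ^+ j) ^+ b i)^*%C).
  rewrite bigA_distr_bigA; apply: eq_bigr => x _.
  by rewrite /mono rmorph_prod -big_split.
under eq_bigr => i _ do rewrite sum_roots_orthogonal //.
rewrite -natr_prod; congr _%:R; rewrite big_split /= prod_nat_const card_ffun !card_ord.
congr muln; have [->|ab] := eqVneq a b; first by rewrite big1 // => i _; rewrite eqxx.
have [i abi] : exists i, a i != b i.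
  apply/existsP; rewrite -negb_forall; apply: contra ab => /forallP abE.
  by apply/eqP/mpoly.mnmP => i; apply/eqP.
by rewrite (bigD1 i) //= (negbTE abi).
Qed.

Lemma parseval (s : seq (mpoly.multinom n)) (c : mpoly.multinom n -> R[i]) :
  uniq s -> (forall a i, a \in s -> (a i < M)%N) ->
  torus_mean (fun z => normc (\sum_(a <- s) c a * mono a z) ^+ 2) =
  \sum_(a <- s) normc (c a) ^+ 2.
Proof.
move=> us sM; apply: (canLR (mulKf _)); first by rewrite gt_eqF ?torus_card_gt0.
apply: RtoC_inj; rewrite RtoCM RtoC_nat !RtoC_sum.
under eq_bigr => x _ do rewrite normc_sqrC rmorph_sum big_distrlr /=.
rewrite exchange_big big_distrr /=; rewrite !big_seq; apply: eq_bigr => a sa.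
rewrite exchange_big /= (bigD1_seq a) //= [X in _ + X]big1_seq ?addr0 => [|b /andP[ba sb]].

  under eq_bigr => x _ do rewrite conjcM mulrACA.
  rewrite -big_distrr /= mono_orthogonal; try by move=> i; exact: sM.
  by rewrite eqxx muln1 normc_sqrC mulrC.
under eq_bigr => x _ do rewrite conjcM mulrACA.
rewrite -big_distrr /= mono_orthogonal; try by move=> i; exact: sM.
by rewrite eq_sym (negbTE ba) muln0 mulr0.
Qed.

Lemma torus_mean_ge0 f : (forall z, 0 <= f z) -> 0 <= torus_mean f.
Proof.
by move=> f0; rewrite mulr_ge0 ?invr_ge0 ?ler0n // sumr_ge0.
Qed.

Lemma torus_mean_sum (I : Type) (s : seq I) (f : I -> ('I_n -> R[i]) -> R) :
  torus_mean (fun z => \sum_(k <- s) f k z) = \sum_(k <- s) torus_mean (f k).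
Proof. by rewrite /torus_mean exchange_big big_distrr. Qed.

Lemma torus_mean_le f g :
  (forall z, (forall i, normc (z i) = 1) -> f z <= g z) ->
  torus_mean f <= torus_mean g.
Proof.
move=> fg; apply: ler_wpM2l; first by rewrite invr_ge0 ler0n.
by apply: ler_sum => x _; apply: fg => i; exact: normc_torus_pt.
Qed.

Lemma torus_mean_cst (c : R) : torus_mean (fun=> c) = c.
Proof.
rewrite /torus_mean sumr_const -[c *+ _]mulr_natl mulKf // gt_eqF //.
exact: torus_card_gt0.
Qed.

Lemma torus_mean_hoelder (u v : R) (f g : ('I_n -> R[i]) -> R) : 0 < u -> 0 < v -> u + v = 1 ->
  (forall z, 0 <= f z) -> (forall z, 0 <= g z) ->
  torus_mean (fun z => f z `^ u * g z `^ v) <= torus_mean f `^ u * torus_mean g `^ v.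
Proof.
move=> u0 v0 uv f0 g0; rewrite /torus_mean; set K := _^-1.
have K0 : 0 <= K by rewrite invr_ge0 ler0n.
have Kn : K != 0 by rewrite invr_eq0 gt_eqF ?torus_card_gt0.
rewrite !powRM ?sumr_ge0 // mulrACA -powRD ?uv ?powRr1 //; last by rewrite Kn implybT.
by apply: ler_wpM2l => //; exact: hoelder_sum.
Qed.

End TorusMean.

(** * Comparison of the second and fourth moments of a polynomial *)

Section Hypercontractivity.
Variables (R : realType) (n : nat).
Implicit Types P Q : mpoly.mpoly n R[i].

Lemma sum_eq_le1 (T : eqType) (s : seq T) (x : T) : uniq s ->
  (\sum_(y <- s) (y == x) <= 1)%N.
Proof.
move=> us; have -> : (\sum_(y <- s) (y == x) = count_mem x s)%N.
  by rewrite -sum1_count [RHS]big_mkcond /=; apply: eq_bigr => y _; case: eqP.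
by rewrite count_uniq_mem // leq_b1.
Qed.

Lemma mevalE_mono P (z : 'I_n -> R[i]) :
  mpoly.meval z P = \sum_(a <- mpoly.msupp P) mpoly.mcoeff a P * mono a z.
Proof. exact: mpoly.mevalE. Qed.

Lemma mnm_le_mdeg (a : mpoly.multinom n) i : (a i <= mpoly.mdeg a)%N.
Proof. by rewrite mpoly.mdegE (bigD1 i) //= leq_addr. Qed.

Lemma parseval_mpoly (M : nat) (w : R[i]) P : (0 < M)%N -> M.-primitive_root w ->
  (forall a, a \in mpoly.msupp P -> (mpoly.mdeg a < M)%N) ->
  torus_mean M w (fun z => normc (mpoly.meval z P) ^+ 2) =
  \sum_(a <- mpoly.msupp P) normc (mpoly.mcoeff a P) ^+ 2.
Proof.
move=> M0 wM PM; rewrite -(parseval M0 wM (fun a => mpoly.mcoeff a P)).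
- by congr (_ * _); apply: eq_bigr => x _; rewrite mevalE_mono.
- exact: mpoly.msupp_uniq.
- by move=> a i /PM; apply: leq_ltn_trans; exact: mnm_le_mdeg.
Qed.

(** A monomial with exponent g has the product of the g_i + 1 as its number of divisors, and g_i + 1
    <= 2^(g_i). *)
Lemma count_mnm_le (s : seq (mpoly.multinom n)) (g : mpoly.multinom n) : uniq s ->
  (count (fun a : mpoly.multinom n => [forall i, (a i <= g i)%N]) s <= 2 ^ mpoly.mdeg g)%N.
Proof.
move=> us; rewrite -size_filter; set t := seq.filter _ _.
have ut : uniq t by rewrite filter_uniq.
pose D := (mpoly.mdeg g).+1.
pose F (i : 'I_n) := [pred j : 'I_D | (j <= g i)%N].
pose h (a : mpoly.multinom n) : {ffun 'I_n -> 'I_D} := [ffun i => inord (a i)].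
have hE a i : a \in t -> h a i = a i :> nat.
  rewrite mem_filter ffunE => /andP[/forallP ag _]; rewrite inordK // ltnS.
  exact: leq_trans (ag i) (mnm_le_mdeg g i).
rewrite -(size_map h); have uh : uniq (map h t).
  rewrite map_inj_in_uniq // => a b ta tb /ffunP hab; apply/mpoly.mnmP => i.
  by rewrite -hE // -[RHS]hE // hab.
rewrite -(card_uniqP uh); apply: (@leq_trans #|family F|).
  apply: subset_leq_card; apply/fintype.subsetP => _ /mapP[a ta ->].
  apply/familyP => i; rewrite inE hE //.
  by move: ta; rewrite mem_filter => /andP[/forallP].
rewrite card_family foldrE big_map big_enum /= mpoly.mdegE expn_sum.
apply: leq_prod => i _.
apply: (@leq_trans (g i).+1); last exact: ltn_expl.
rewrite -[X in (_ <= X)%N](card_ord (g i).+1).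
pose k (j : 'I_D) : 'I_(g i).+1 := inord j.
have kinj : {in F i &, injective k}.
  move=> j1 j2; rewrite !inE => l1 l2 /(congr1 val); rewrite /= !inordK ?ltnS // => E.
  exact: val_inj.
by rewrite -(card_in_image kinj) max_card.
Qed.

(* The square of P has Taylor coefficients which are sums over the
   decompositions c = a + b; there are at most 2^|c| <= 4^m of them. *)
Lemma torus_mean4 (M m : nat) (w : R[i]) P : (2 * m < M)%N -> M.-primitive_root w ->
  (forall a, a \in mpoly.msupp P -> (mpoly.mdeg a <= m)%N) ->
  torus_mean M w (fun z => normc (mpoly.meval z P) ^+ 4) <=
  4 ^+ m * torus_mean M w (fun z => normc (mpoly.meval z P) ^+ 2) ^+ 2.
Proof.
move=> mM wM Pm; have M0 : (0 < M)%N by case: (M) mM.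
set s := mpoly.msupp P; set c := fun a => mpoly.mcoeff a P.
have us : uniq s by exact: mpoly.msupp_uniq.
rewrite (parseval_mpoly M0 wM); last first.
  by move=> a /Pm am; apply: leq_ltn_trans mM; rewrite mul2n -addnn (leq_trans am) ?leq_addr.
pose S (g : mpoly.multinom n) (u : mpoly.multinom n -> mpoly.multinom n -> R) : R :=
  \sum_(a <- s) \sum_(b <- s) u a b *+ (mpoly.mnm_add a b == g).
have P2E : P ^+ 2 = \sum_(a <- s) \sum_(b <- s) (c a * c b) *: mpoly.mpolyX _ (mpoly.mnm_add a b).
  rewrite expr2 {1 2}[P]mpoly.mpolyE big_distrlr /=; apply: eq_bigr => a _; apply: eq_bigr => b _.
  by rewrite -scalerAl -scalerAr scalerA mpoly.mpolyXD.
have P2c g : mpoly.mcoeff g (P ^+ 2) = \sum_(a <- s) \sum_(b <- s) (c a * c b) *+ (mpoly.mnm_add a b == g).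
  rewrite P2E raddf_sum; apply: eq_bigr => a _; rewrite raddf_sum; apply: eq_bigr => b _.
  by rewrite /= mpoly.mcoeffZ mpoly.mcoeffX mulr_natr.
set s2 := [seq (a, b) | a <- s, b <- s].
pose e (p : mpoly.multinom n * mpoly.multinom n) := mpoly.mnm_add p.1 p.2.
pose d (p : mpoly.multinom n * mpoly.multinom n) : R := normc (c p.1) * normc (c p.2).
have coef_le g : normc (mpoly.mcoeff g (P ^+ 2)) ^+ 2 <=
    4 ^+ m * \sum_(p <- s2) d p ^+ 2 *+ (e p == g).
  (* The repeated indicator of e p = g lets Cauchy-Schwarz split off the number of decompositions of
     g from the sum of squares. *)
  apply: (@le_trans _ _ ((\sum_(p <- s2) d p *+ (e p == g) * (e p == g)%:R) ^+ 2)).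
    rewrite ler_pXn2r ?nnegrE ?normc_ge0 //; last first.
      by apply: sumr_ge0 => p _; rewrite mulr_ge0 ?mulrn_wge0 ?mulr_ge0 ?normc_ge0.
    rewrite P2c [leRHS]big_allpairs; apply: le_trans (normc_sum _ _ _) _.
    apply: ler_sum => a _; apply: le_trans (normc_sum _ _ _) _.
    apply: ler_sum => b _; rewrite /e /d /=; case: eqP => _.
      by rewrite !mulr1n mulr1 Normc.normcM.
    by rewrite !mulr0n Normc.normc0 mulr0.
  apply: le_trans (cauchy_schwarz_sum _ _ _) _.
  rewrite mulrC; apply: ler_pM.
  - by apply: sumr_ge0 => p _; exact: sqr_ge0.
  - by apply: sumr_ge0 => p _; exact: sqr_ge0.
  - have [[p ps /eqP pg]|none] := pselect (exists2 p, p \in s2 & e p == g); last first.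
      rewrite big1_seq ?exprn_ge0 // => p /andP[_ ps].
      have [E|_] := boolP (e p == g); last by rewrite expr0n.
      by case: none; exists p.
    have g2m : (mpoly.mdeg g <= 2 * m)%N.
      move: ps pg => /allpairsP[[a b] /= [sa sb ->]] <-; rewrite /e mpoly.mdegD /=.
      by rewrite mul2n -addnn leq_add // Pm.
    apply: (@le_trans _ _ (2 ^ mpoly.mdeg g)%:R); last first.
      by rewrite -[4]/((2 ^ 2)%:R) -natrX -expnM ler_nat leq_exp2l.
    apply: le_trans (_ : _ <= (count (fun a : mpoly.multinom n => [forall i, (a i <= g i)%N]) s)%:R) _; last first.
      by rewrite ler_nat count_mnm_le.
    rewrite big_allpairs -sum1_count natr_sum big_mkcond [leRHS]big_mkcond /=.
    apply: ler_sum => a _; rewrite /e /=.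
    have [ag|nag] := boolP [forall i, (a i <= g i)%N]; last first.
      rewrite big1 // => b _; case: eqP => [ab|]; last by rewrite expr0n.
      by case/negP: nag; apply/forallP => i; rewrite -ab mpoly.mnmDE leq_addr.
    pose b0 := mpoly.mnm_sub g a.
    apply: (@le_trans _ _ (\sum_(b <- s) (b == b0)%:R)).
      apply: ler_sum => b _; case: eqP => [ab|_]; last by rewrite expr0n ler0n.
      suff -> : b = b0 by rewrite eqxx expr1n.
      by rewrite /b0 -ab mpoly.addmC mpoly.addmK.
    by rewrite -natr_sum ler_nat sum_eq_le1.
  - apply: ler_sum => p _; case: eqP => _; first by rewrite !mulr1n.
    by rewrite !mulr0n expr0n.
(* |P|^4 = |P^2|^2, and Parseval for P^2 is where 2m < M is used: its degrees reach 2m. *)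
have -> : torus_mean M w (fun z => normc (mpoly.meval z P) ^+ 4) =
          torus_mean M w (fun z => normc (mpoly.meval z (P ^+ 2)) ^+ 2).
  congr (_ * _); apply: eq_bigr => x _.
  by rewrite [P ^+ 2]expr2 mpoly.mevalM Normc.normcM -expr2 -exprM.
rewrite (parseval_mpoly M0 wM); last first.
  move=> g; rewrite mpoly.mcoeff_msupp P2c => nz.
  have [[p ps /eqP <-]|none] := pselect (exists2 p, p \in s2 & e p == g).
    move: ps => /allpairsP[[a b] /= [sa sb ->]]; rewrite /e mpoly.mdegD /=.
    by apply: leq_ltn_trans mM; rewrite mul2n -addnn leq_add // Pm.
  case/eqP: nz; rewrite big1_seq // => a /andP[_ sa]; rewrite big1_seq // => b /andP[_ sb].
  case: eqP => // ab; case: none; exists (a, b); last by rewrite /e ab.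
  by apply/allpairsP; exists (a, b).
apply: le_trans (ler_sum _ (fun g _ => coef_le g)) _.
rewrite -big_distrr /= ler_wpM2l ?exprn_ge0 // exchange_big /=.
rewrite big_allpairs [leRHS]expr2 big_distrlr /=.
apply: ler_sum => a _; apply: ler_sum => b _.
rewrite /d /= -exprMn; under eq_bigr => g _ do rewrite -mulr_natr.
rewrite -big_distrr /= -natr_sum ler_piMr ?sqr_ge0 //.
rewrite lern1; under eq_bigr => g _ do rewrite eq_sym.
by rewrite sum_eq_le1 // mpoly.msupp_uniq.
Qed.

End Hypercontractivity.

(** * The Bohnenblust-Hille inequality *)

Section LowMoments.
Variables (R : realType) (n : nat).
Implicit Types P Q : mpoly.mpoly n R[i].

(** Let p = 2(k+1)/(k+2). Hoelder bounds the second moment by the p-th and the fourth, with weights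
    (k+2)/(k+3) and 1/(k+3). The bound 4^m E2^2 for the fourth moment brings back a power of E2
    smaller than 1, which is divided out. The loss per degree, 2^(1/(k+1)), tends to 1 as k
    grows. *)
Lemma torus_mean_low (M m k : nat) (w : R[i]) P : (2 * m < M)%N -> M.-primitive_root w ->
  (forall a, a \in mpoly.msupp P -> (mpoly.mdeg a <= m)%N) ->
  Num.sqrt (torus_mean M w (fun z => normc (mpoly.meval z P) ^+ 2)) <=
  2 `^ (m%:R / k.+1%:R) *
  torus_mean M w (fun z => normc (mpoly.meval z P) `^ (2 * k.+1%:R / k.+2%:R))
     `^ (k.+2%:R / (2 * k.+1%:R)).
Proof.
move=> mM wM Pm; have M0 : (0 < M)%N by case: (M) mM.
have [K KE k1] : exists2 K : R, k.+1%:R = K & 0 < K by exists k.+1%:R => //; rewrite ltr0n.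
have k2E : k.+2%:R = K + 1 by rewrite -KE natr1.
rewrite KE k2E; set E2 := torus_mean _ _ _; set Ep := torus_mean _ _ _.
have E20 : 0 <= E2 by apply: torus_mean_ge0 => z; exact: sqr_ge0.
have Ep0 : 0 <= Ep by apply: torus_mean_ge0 => z; exact: powR_ge0.
have [->|E2n] := eqVneq E2 0; first by rewrite sqrtr0 mulr_ge0 ?powR_ge0.
have E2p : 0 < E2 by rewrite lt_def E2n.
have Kn : K != 0 by rewrite gt_eqF.
have K1n : K + 1 != 0 by rewrite gt_eqF ?addr_gt0.
have K2n : K + 2 != 0 by rewrite gt_eqF ?addr_gt0.
have u0 : 0 < (K + 1) / (K + 2) by rewrite divr_gt0 ?addr_gt0.
have v0 : 0 < (K + 2)^-1 by rewrite invr_gt0 addr_gt0.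
have uv : (K + 1) / (K + 2) + (K + 2)^-1 = 1 by field.
have : E2 <= Ep `^ ((K + 1) / (K + 2)) * (4 ^+ m * E2 ^+ 2) `^ (K + 2)^-1.
  apply: le_trans _ (ler_wpM2l (powR_ge0 _ _)
    (ler_powR2 (ltW v0) _ (torus_mean4 mM wM Pm))); last first.
    by apply: torus_mean_ge0 => z; rewrite exprn_ge0 ?normc_ge0.
  apply: le_trans _ (torus_mean_hoelder w M0 u0 v0 uv _ _); first last.
  - by move=> z; rewrite exprn_ge0 ?normc_ge0.
  - by move=> z; exact: powR_ge0.
  apply: torus_mean_le => // z _; set r := normc _.
  have r0 : 0 <= r by exact: normc_ge0.
  rewrite -!powR_mulrn // -!powRrM -powRD; last first.
    by rewrite implybE gt_eqF // addr_gt0 // !mulr_gt0 // ?invr_gt0 ?addr_gt0 ?ltr0n.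
  rewrite le_eqVlt; apply/orP; left; apply/eqP; congr (_ `^ _).
  by field; rewrite ?Kn ?K1n ?K2n.
rewrite powRM ?exprn_ge0 // -!powR_mulrn // -!powRrM => H.
have {}H : E2 `^ (K / (K + 2)) <= Ep `^ ((K + 1) / (K + 2)) * 4 `^ (m%:R / (K + 2)).
  have D : 0 < E2 `^ (2 / (K + 2)) by rewrite powR_gt0.
  rewrite -(ler_pM2r D) -powRD; last by rewrite E2n implybT.
  have -> : K / (K + 2) + 2 / (K + 2) = 1 by field.
  by rewrite powRr1 // -mulrA.
have c0 : 0 <= (K + 2) / (2 * K) by rewrite divr_ge0 ?mulr_ge0 ?addr_ge0 ?ltW.
have := ler_powR2 c0 (powR_ge0 _ _) H.
rewrite powRM ?powR_ge0 // -!powRrM.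
have -> : K / (K + 2) * ((K + 2) / (2 * K)) = 2^-1 by field; rewrite ?Kn ?K1n ?K2n.
have -> : (K + 1) / (K + 2) * ((K + 2) / (2 * K)) = (K + 1) / (2 * K) by field; rewrite ?Kn ?K1n ?K2n.
have -> : m%:R / (K + 2) * ((K + 2) / (2 * K)) = 2^-1 * (m%:R / K) by field; rewrite ?Kn ?K1n ?K2n.
rewrite powR12_sqrt // [4 `^ _]powRrM powR12_sqrt //.
have -> : Num.sqrt 4 = 2 :> R.
  have -> : 4 = 2 ^+ 2 :> R by rewrite -natrX.
  by rewrite sqrtr_sqr ger0_norm.
by rewrite mulrC.
Qed.

End LowMoments.

Section Multilinear.
Variables (R : realType) (n : nat).

(** The value at the vectors [ws] of the multilinear form with coefficient array [a], contracted
    from the first index on. *)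
Fixpoint mform (ws : seq ('I_n -> R[i])) (a : seq 'I_n -> R[i]) : R[i] :=
  if ws is w :: ws' then \sum_(j < n) w j * mform ws' (fun s => a (j :: s))
  else a [::].

Lemma mform_sum (I : Type) (r : seq I) ws (c : I -> R[i]) (a : I -> seq 'I_n -> R[i]) :
  mform ws (fun s => \sum_(i <- r) c i * a i s) = \sum_(i <- r) c i * mform ws (a i).
Proof.
elim: ws a => [|w ws IH] a //=.
under eq_bigr => j _ do rewrite IH big_distrr /=.
rewrite exchange_big; apply: eq_bigr => i _; rewrite big_distrr /=.
by apply: eq_bigr => j _; rewrite mulrCA.
Qed.

(** Degree m = 1 and k = 0 in the comparison of moments: the exponent 2(k+1)/(k+2) is 1 and the
    constant is 2. Cube roots of unity suffice, as 2m < 3. *)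
Lemma khinchine (w : R[i]) (x : 'I_n -> R[i]) : 3.-primitive_root w ->
  l2norm (index_enum 'I_n) (fun j => normc (x j)) <=
  2 * torus_mean 3 w (fun z => normc (\sum_(j < n) z j * x j)).
Proof.
move=> w3; pose P : mpoly.mpoly n R[i] := \sum_(j < n) x j *: mpoly.mpolyX _ (mpoly.mnm1 j).
have PE z : mpoly.meval z P = \sum_(j < n) z j * x j.
  rewrite /P raddf_sum; apply: eq_bigr => j _.
  by rewrite /= mpoly.mevalZ mpoly.mevalXU mulrC.
have Pc j : mpoly.mcoeff (mpoly.mnm1 j) P = x j.
  rewrite /P raddf_sum (bigD1 j) //= big1 ?addr0 => [|i ij].
    by rewrite mpoly.mcoeffZ mpoly.mcoeffX eqxx mulr1.
  rewrite mpoly.mcoeffZ mpoly.mcoeffX; case: eqP => [/mpoly.mnmP E|]; last by rewrite mulr0.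
  by move: (E i); rewrite !mpoly.mnm1E eqxx eq_sym (negbTE ij).
have Pdeg a : a \in mpoly.msupp P -> (mpoly.mdeg a <= 1)%N.
  rewrite mpoly.mcoeff_msupp /P raddf_sum; apply: contraR; rewrite -ltnNge => a1.
  rewrite big1 // => j _ /=; rewrite mpoly.mcoeffZ mpoly.mcoeffX.
  case: eqP => [E|]; last by rewrite mulr0.
  by rewrite -E mpoly.mdeg1 in a1.
have := @torus_mean_low R n 3 1 0 w P isT w3 Pdeg.
rewrite !mulr1 !divr1 divff // powRr1 // powRr1; last first.
  by apply: torus_mean_ge0 => z; exact: powR_ge0.
have -> : torus_mean 3 w (fun z => normc (mpoly.meval z P) `^ 1) =
          torus_mean 3 w (fun z => normc (\sum_(j < n) z j * x j)).
  by congr (_ * _); apply: eq_bigr => y _; rewrite powRr1 ?normc_ge0 // PE.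
apply: le_trans; rewrite /l2norm le_eqVlt; apply/orP; left; apply/eqP; congr Num.sqrt.
pose s : seq (mpoly.multinom n) := [seq mpoly.mnm1 j | j <- index_enum 'I_n].
transitivity (\sum_(a <- s) normc (mpoly.mcoeff a P) ^+ 2).
  by rewrite big_map; apply: eq_bigr => j _; rewrite Pc.
rewrite -(parseval (isT : (0 < 3)%N) w3).
- congr (_ * _); apply: eq_bigr => y _; congr (normc _ ^+ 2).
  rewrite PE big_map; apply: eq_bigr => j _; rewrite Pc mulrC; congr (_ * _).
  rewrite /mono (bigD1 j) //= mpoly.mnm1E eqxx expr1 big1 ?mulr1 // => i ij.
  by rewrite mpoly.mnm1E eq_sym (negbTE ij) expr0.
- rewrite map_inj_uniq ?index_enum_uniq // => i j /mpoly.mnmP /(_ i).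
  by rewrite !mpoly.mnm1E eqxx; case: eqP.
- by move=> a i /mapP[j _ ->]; rewrite mpoly.mnm1E; case: eqP.
Qed.

Lemma torus_mean_max (M : nat) (w : R[i]) (f : ('I_n -> R[i]) -> R) :
  (0 < M)%N -> M.-primitive_root w ->
  exists2 z : 'I_n -> R[i], (forall i, normc (z i) = 1) & torus_mean M w f <= f z.
Proof.
move=> M0 wM.
have x0 : {ffun 'I_n -> 'I_M} by exact: [ffun=> Ordinal M0].
have [x _ xmax] := @arg_maxP _ _ _ x0 xpredT (fun x => f (torus_pt w x)) isT.
exists (torus_pt w x); first by move=> i; exact: (normc_torus_pt M0 wM).
rewrite -[leRHS](torus_mean_cst n w M0).
apply: ler_wpM2l; first by rewrite invr_ge0 ler0n.
by apply: ler_sum => y _; exact: xmax.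
Qed.

(** Each use of Khinchine removes one index for a factor 2. The sum over [r] is formed before a mean
    is replaced by its largest value, so one list [ws] serves all j. *)
Lemma khinchine_iter (k : nat) (J : Type) (r : seq J) (a : J -> seq 'I_n -> R[i]) :
  exists ws : seq ('I_n -> R[i]),
    [/\ size ws = k, List.Forall (fun w => forall i, normc (w i) = 1) ws &
    \sum_(j <- r) l2norm (index_enum {: k.-tuple 'I_n}) (fun t => normc (a j t)) <=
    2 ^+ k * \sum_(j <- r) normc (mform ws (a j))].
Proof.
have [w3 w3prim] := @exists_prim_root R 3 isT.
elim: k J r a => [|k IH] J r a.
  exists [::]; split => //; rewrite expr0 mul1r; apply: ler_sum => j _.
  rewrite /l2norm (big_tuple_nil (fun t => normc (a j t) ^+ 2)).
  by rewrite sqrtr_sqr ger0_norm ?normc_ge0.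
pose b z j (t : seq 'I_n) := \sum_(i < n) z i * a j (i :: t).
pose F z := \sum_(j <- r) l2norm (index_enum {: k.-tuple 'I_n}) (fun t => normc (b z j t)).
have [z z1 zF] := torus_mean_max F (isT : (0 < 3)%N) w3prim.
have [ws [szws ws1 wsP]] := IH J r (b z).
exists (z :: ws); split; [by rewrite /= szws|by constructor|].
have -> : \sum_(j <- r) normc (mform (z :: ws) (a j)) =
          \sum_(j <- r) normc (mform ws (b z j)).
  by apply: eq_bigr => j _; rewrite /b mform_sum.
apply: (@le_trans _ _ (2 * F z)); last by rewrite exprS -mulrA ler_wpM2l.
apply: (@le_trans _ _ (2 * torus_mean 3 w3 F)); last by rewrite ler_wpM2l.
rewrite /F torus_mean_sum big_distrr /=; apply: ler_sum => j _.
pose K : R := #|{ffun 'I_n -> 'I_3}|%:R^-1.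
have K0 : 0 <= K by rewrite invr_ge0 ler0n.
(* The mean given by Khinchine in the first index is written as a sum, so that Minkowski can take it
   out of the l2 norm. *)
apply: (@le_trans _ _ (l2norm (index_enum {: k.-tuple 'I_n}) (fun t =>
   \sum_x (2 * K) * normc (b (torus_pt w3 x) j t)))).
  rewrite [leLHS]/l2norm (big_tuple_cons k (fun t => normc (a j t) ^+ 2)) exchange_big /=.
  apply: ler_wsqrtr; apply: ler_sum => t _.
  rewrite -sqr_l2norm ler_pXn2r ?nnegrE ?l2norm_ge0 //; last first.
    by apply: sumr_ge0 => x _; rewrite !mulr_ge0 ?normc_ge0.
  apply: le_trans (khinchine (fun i => a j (i :: t)) w3prim) _.
  by rewrite -big_distrr /= -mulrA; exact: lexx.
apply: le_trans (l2norm_sum _ _ _) _.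
rewrite /torus_mean -/K mulrA big_distrr /=; apply: ler_sum => x _.
by rewrite l2normZ // mulr_ge0.
Qed.

Lemma exists_phase (u : R[i]) : exists2 v : R[i], normc v = 1 & v * u = (normc u)%:C%C.
Proof.
have [->|u0] := eqVneq u 0; first by exists 1; rewrite ?Normc.normc1 // mulr0 Normc.normc0.
have nu0 : normc u != 0 by apply: contra u0 => /eqP /Normc.eq0_normc ->.
exists (u^*%C / (normc u)%:C%C).
  by rewrite Normc.normcM Normc.normcV normc_conj normc_real ger0_norm ?normc_ge0 ?divff.
rewrite mulrAC [_ * u]mulrC -normc_sqrC expr2 RtoCM mulfK //.
by apply: contra nu0 => /eqP /RtoC_inj ->.
Qed.

(** Blei's inequality leaves an l1 norm in the first index and an l2 norm in the k others, which
    Khinchine removes for 2^k. The l1 norm costs nothing: with the phases [v] as first vector, the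
    sum of the |u j| is a single value of the form. *)
Lemma bohnenblust_hille (k : nat) (a : seq 'I_n -> R[i]) (H : R) :
  (forall s t, perm_eq s t -> a s = a t) ->
  (forall ws, size ws = k.+1 -> List.Forall (fun w => forall i, normc (w i) = 1) ws ->
     normc (mform ws a) <= H) ->
  \sum_(t : k.+1.-tuple 'I_n) normc (a t) `^ (2 * k.+1%:R / k.+2%:R) <=
  (2 ^+ k * H) `^ (2 * k.+1%:R / k.+2%:R).
Proof.
move=> asym aH.
apply: le_trans (@blei_symmetric R 'I_n k (fun s => normc (a s)) _ _) _.
- by move=> s; exact: normc_ge0.
- by move=> s t st; rewrite (asym s t).
apply: ler_powR2; first by rewrite divr_ge0 // mulr_ge0.
  by apply: sumr_ge0 => j _; exact: l2norm_ge0.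
have [ws [szws ws1 wsP]] := khinchine_iter k (index_enum 'I_n) (fun j t => a (j :: t)).
apply: le_trans wsP _; apply: ler_wpM2l; first by rewrite exprn_ge0.
pose u j := mform ws (fun t => a (j :: t)).
pose v j := s2val (cid2 (exists_phase (u j))).
have v1 j : normc (v j) = 1 by rewrite /v; case: cid2.
have vu j : v j * u j = (normc (u j))%:C%C by rewrite /v; case: cid2.
have := aH (v :: ws); rewrite /= szws => /(_ erefl) /(_ (List.Forall_cons _ v1 ws1)).
apply: le_trans; rewrite -/(u _).
under [X in _ <= normc X]eq_bigr => j _ do rewrite -/(u j) vu.
by rewrite -RtoC_sum normc_real ler_norm.
Qed.

End Multilinear.

(** * Derivatives of polynomials and Cauchy estimates *)

Section Derivatives.
Variables (R : realType) (n : nat).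
Implicit Types P Q : mpoly.mpoly n R[i].

Definition dir_deriv (v : 'I_n -> R[i]) P : mpoly.mpoly n R[i] :=
  \sum_(j < n) v j *: mpoly.mderiv j P.

(** Passing through the exponent that counts the letters makes invariance under permutations of the
    word immediate; the Bohnenblust-Hille inequality asks for this symmetry. *)
Definition word_deriv (s : seq 'I_n) P : mpoly.mpoly n R[i] :=
  mpoly.mderivm (\big[mpoly.mnm_add/mpoly.mnm0]_(j <- s) mpoly.mnm1 j) P.

Lemma word_deriv_nil P : word_deriv [::] P = P.
Proof. by rewrite /word_deriv big_nil mpoly.mderivm0m. Qed.

Lemma word_deriv_cons j s P : word_deriv (j :: s) P = word_deriv s (mpoly.mderiv j P).
Proof. by rewrite /word_deriv big_cons mpoly.mderivmDm mpoly.mderivmU1m. Qed.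

Lemma word_deriv_perm s t P : perm_eq s t -> word_deriv s P = word_deriv t P.
Proof. by move=> st; rewrite /word_deriv (perm_big t). Qed.

Lemma meval_dir_deriv z v P :
  mpoly.meval z (dir_deriv v P) = \sum_(j < n) v j * mpoly.meval z (mpoly.mderiv j P).
Proof. by rewrite raddf_sum; apply: eq_bigr => j _; rewrite /= mpoly.mevalZ. Qed.

(** The property T holds for constants and variables and is stable under sums and products, the
    coefficient of degree 1 obeying Leibniz's rule; these generate all polynomials. *)
Lemma restrict_to_line P (z v : 'I_n -> R[i]) :
  exists2 G : {poly R[i]}, forall t, G.[t] = mpoly.meval (fun i => z i + t * v i) P &
  G`_1 = mpoly.meval z (dir_deriv v P).
Proof.
pose T Q := exists2 G : {poly R[i]},
  forall t, G.[t] = mpoly.meval (fun i => z i + t * v i) Q &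
  G`_1 = mpoly.meval z (dir_deriv v Q).
have G0 (G : {poly R[i]}) Q : (forall t, G.[t] = mpoly.meval (fun i => z i + t * v i) Q) ->
    G`_0 = mpoly.meval z Q.
  move=> GE; rewrite -horner_coef0 GE; apply: mpoly.meval_eq => i.
  by rewrite mul0r addr0.
have TC c : T (mpoly.mpolyC n c).
  exists c%:P => [t|]; first by rewrite hornerC mpoly.mevalC.
  rewrite coefC /= meval_dir_deriv big1 // => j _.
  by rewrite mpoly.mderivC raddf0 mulr0.
have TX i : T (mpoly.mpolyX _ (mpoly.mnm1 i)).
  exists ((z i)%:P + v i *: 'X).
    by move=> t; rewrite !hornerE mpoly.mevalXU mulrC.
  rewrite coefD coefC coefZ coefX /= add0r mulr1 meval_dir_deriv (bigD1 i) //= big1 ?addr0.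
    rewrite mpoly.mderivX mpoly.mnm1E eqxx scale1r.
    have -> : mpoly.mnm_sub (mpoly.mnm1 i) (mpoly.mnm1 i) = mpoly.mnm0.
      by apply/mpoly.mnmP => j; rewrite mpoly.mnmBE subnn mpoly.mnm0E.
    by rewrite mpoly.mpolyX0 mpoly.meval1 mulr1.
  move=> j ji; rewrite mpoly.mderivX mpoly.mnm1E eq_sym (negbTE ji) scale0r.
  by rewrite raddf0 mulr0.
have TD Q1 Q2 : T Q1 -> T Q2 -> T (Q1 + Q2).
  move=> [G1 E1 D1] [G2 E2 D2]; exists (G1 + G2).
    by move=> t; rewrite hornerD E1 E2 mpoly.mevalD.
  rewrite coefD D1 D2 !meval_dir_deriv -big_split; apply: eq_bigr => j _.
  by rewrite mpoly.mderivD mpoly.mevalD mulrDr.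
have TM Q1 Q2 : T Q1 -> T Q2 -> T (Q1 * Q2).
  move=> [G1 E1 D1] [G2 E2 D2]; exists (G1 * G2).
    by move=> t; rewrite hornerM E1 E2 mpoly.mevalM.
  rewrite coefM big_ord_recr big_ord1 /= D1 D2 (G0 _ _ E1) (G0 _ _ E2) !meval_dir_deriv.
  rewrite big_distrr big_distrl -big_split; apply: eq_bigr => j _ /=.
  by rewrite mpoly.mderivM mpoly.mevalD !mpoly.mevalM; ring.
rewrite -/(T P); move: P; apply: mpoly.mpolyind => [|c m p _ _ IH].
  by rewrite -(mpoly.mpolyC0 n); exact: TC.
apply: TD => //; rewrite -mpoly.mul_mpolyC; apply: (TM); first exact: TC.
rewrite mpoly.mpolyXE_id; apply: big_ind; [exact: (TC 1)|exact: TM|].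
move=> i _; elim: (m i) => [|k IHk]; first by rewrite expr0; exact: (TC 1).
by rewrite exprS; apply: TM.
Qed.

(* Cauchy's estimate, averaging over roots of unity instead of integrating. *)
Lemma cauchy_dir P (v z : 'I_n -> R[i]) (B r t : R) : 0 < t ->
  (forall y, (forall i, normc (y i) <= r + t) -> normc (mpoly.meval y P) <= B) ->
  (forall i, normc (v i) <= 1) -> (forall i, normc (z i) <= r) ->
  normc (mpoly.meval z (dir_deriv v P)) <= B / t.
Proof.
move=> t0 PB v1 zr; have [G GE G1] := restrict_to_line P z v.
rewrite -G1 ler_pdivlMr //.
(* M must exceed every degree in G and also 1, the exponent that is extracted, even when G is 0 or
   constant. *)
pose M := (size G).+2.
have [w wM] := @exists_prim_root R M isT.
have w1 k : normc (w ^+ k) = 1.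
  by rewrite normcX (@normc_unity_root _ _ M) ?expr1n // prim_expr_order.
have kM (k : 'I_(size G)) : (k < M)%N by rewrite /M; move: (ltn_ord k); lia.
have E : \sum_(x < M) G.[t%:C%C * w ^+ x] * ((w ^+ x) ^+ 1)^*%C = (M%:R * (t%:C%C * G`_1)).
  under eq_bigr => x _ do rewrite horner_coef big_distrl /=.
  rewrite exchange_big /=.
  have inner (k : 'I_(size G)) : \sum_(x < M) G`_k * (t%:C%C * w ^+ x) ^+ k * ((w ^+ x) ^+ 1)^*%C
      = G`_k * t%:C%C ^+ k * (M * (val k == 1))%:R.
    rewrite -(sum_roots_orthogonal (isT : (0 < M)%N) wM (kM k)) // big_distrr /=.
    by apply: eq_bigr => x _; rewrite exprMn !mulrA.
  under eq_bigr => k _ do rewrite inner.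
  have [s1|s1] := leqP (size G) 1.
    rewrite [in RHS]nth_default // !mulr0 big1 // => k _.
    have -> : (val k == 1)%N = false by move: (ltn_ord k) s1 => /=; lia.
    by rewrite muln0 mulr0.
  rewrite (bigD1 (Ordinal s1)) //= muln1 big1 ?addr0 => [|k k1].
    by rewrite expr1 mulrC [t%:C%C * _]mulrC.
  have -> : (val k == 1)%N = false by apply: contraNF k1 => /eqP k1; apply/eqP/val_inj.
  by rewrite muln0 mulr0.
have M0 : 0 < M%:R :> R by rewrite ltr0n.
have := congr1 (@normc R) E.
rewrite !Normc.normcM normc_nat normc_real ger0_norm ?(ltW t0) // => E'.
rewrite mulrC -(ler_pM2l M0) -E'; apply: le_trans (normc_sum _ _ _) _.
rewrite mulr_natl -[M in leRHS]card_ord -sumr_const; apply: ler_sum => x _.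
rewrite Normc.normcM expr1 normc_conj w1 mulr1 GE; apply: PB => i.
apply: le_trans (normcD_le _ _) _; rewrite lerD //.
rewrite !Normc.normcM w1 mulr1 normc_real ger0_norm ?(ltW t0) //.
by rewrite ler_piMr // ltW.
Qed.

(** One Cauchy estimate of radius t per vector: each consumes t of the polydisk on which P is
    bounded and contributes a factor 1/t. *)
Lemma cauchy_mform (B t : R) ws P (r : R) : 0 < t ->
  List.Forall (fun v => forall i, normc (v i) <= 1) ws ->
  (forall y, (forall i, normc (y i) <= r + (size ws)%:R * t) -> normc (mpoly.meval y P) <= B) ->
  forall z, (forall i, normc (z i) <= r) ->
  normc (mform ws (fun s => mpoly.meval z (word_deriv s P))) <= B / t ^+ size ws.
Proof.
move=> t0; elim: ws B P => [|v ws IH] B P vs PB z zr /=.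
  rewrite expr0 divr1 word_deriv_nil; apply: PB => i; by rewrite mul0r addr0.
have [v1 ws1] := (List.Forall_inv vs, List.Forall_inv_tail vs).
have -> : \sum_(j < n) v j * mform ws (fun s => mpoly.meval z (word_deriv (j :: s) P)) =
          mform ws (fun s => mpoly.meval z (word_deriv s (dir_deriv v P))).
  rewrite -mform_sum; congr mform; apply/funext => s.
  rewrite /dir_deriv /word_deriv !raddf_sum; apply: eq_bigr => j _ /=.
  by rewrite -/(word_deriv (j :: s) P) word_deriv_cons mpoly.mderivmZ mpoly.mevalZ.
rewrite exprS invfM mulrA; apply: IH => // y yr.
apply: (cauchy_dir t0 _ v1 yr) => x xr; apply: PB => i.
by apply: le_trans (xr i) _; rewrite -addrA lerD2l -natr1 mulrDl mul1r.
Qed.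

(** The zero polynomial is homogeneous of every degree, so derivatives that vanish need no separate
    case. *)
Definition homogeneous (m : nat) P := forall a, a \in mpoly.msupp P -> mpoly.mdeg a = m.

Lemma meval_scale (m : nat) P (c : R[i]) (z : 'I_n -> R[i]) : homogeneous m P ->
  mpoly.meval (fun i => c * z i) P = c ^+ m * mpoly.meval z P.
Proof.
move=> hP; rewrite !mevalE_mono big_distrr !big_seq; apply: eq_bigr => a /hP am /=.
rewrite mulrCA; congr (_ * _); rewrite -am mpoly.mdegE.
rewrite /mono expr_sum -big_split; apply: eq_bigr => i _.
by rewrite /= exprMn.
Qed.

Lemma homogeneous_deriv (m : nat) P j : homogeneous m P -> homogeneous m.-1 (mpoly.mderiv j P).
Proof.
move=> hP a; rewrite mpoly.mcoeff_msupp mpoly.mcoeff_deriv => nz.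
have /hP : mpoly.mnm_add a (mpoly.mnm1 j) \in mpoly.msupp P.
  by rewrite mpoly.mcoeff_msupp; apply: contra nz => /eqP ->; rewrite mul0rn.
by rewrite mpoly.mdegD mpoly.mdeg1 addn1 => <-.
Qed.

Lemma homogeneous_word (m : nat) P s : homogeneous m P ->
  homogeneous (m - size s) (word_deriv s P).
Proof.
elim: s m P => [|j s IH] m P hP; first by rewrite word_deriv_nil subn0.
by rewrite word_deriv_cons /= subnS -subn1 subnAC subn1; exact/IH/homogeneous_deriv.
Qed.

Definition coef_l1 P : R := \sum_(a <- mpoly.msupp P) normc (mpoly.mcoeff a P).

Lemma coef_l1_seq (s : seq (mpoly.multinom n)) P : uniq s ->
  \sum_(a <- s) normc (mpoly.mcoeff a P) <= coef_l1 P.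
Proof.
move=> us; rewrite (bigID (mem (mpoly.msupp P))) /= [X in _ + X]big1 ?addr0; last first.
  by move=> a aP; rewrite mpoly.memN_msupp_eq0 ?Normc.normc0.
rewrite -big_filter; set t := seq.filter _ _.
have ut : uniq t by exact: filter_uniq.
have tP : {subset t <= mpoly.msupp P} by move=> a; rewrite mem_filter => /andP[].
clearbody t; rewrite /coef_l1 [leRHS](bigID (mem t)) /=.
have -> : \sum_(a <- t) normc (mpoly.mcoeff a P) =
    \sum_(a <- mpoly.msupp P | a \in t) normc (mpoly.mcoeff a P).
  rewrite -[RHS]big_filter; apply: perm_big.
  apply: uniq_perm => //; first by rewrite filter_uniq // mpoly.msupp_uniq.
  by move=> a; rewrite mem_filter; have [ta|//] := boolP (a \in t); rewrite (tP a ta).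
by rewrite lerDl; apply: sumr_ge0 => a _; exact: normc_ge0.
Qed.

(** Positive degree gives each monomial a variable j with a_j > 0, and its coefficient reappears in
    the j-th derivative multiplied by a_j >= 1. *)
Lemma coef_l1_deriv (m : nat) P : homogeneous m.+1 P ->
  coef_l1 P <= \sum_(j < n) coef_l1 (mpoly.mderiv j P).
Proof.
move=> hP.
apply: (@le_trans _ _ (\sum_(j < n) \sum_(a <- mpoly.msupp P | (0 < a j)%N)
   normc (mpoly.mcoeff a P))).
  rewrite (exchange_big_dep xpredT) //= /coef_l1 !big_seq; apply: ler_sum => a /hP am.
  have [j aj] : exists j, (0 < a j)%N.
    apply/existsP; apply: contraPT am => /existsPn a0.
    rewrite mpoly.mdegE big1 // => j _.
    by apply/eqP; rewrite -leqn0 leqNgt; exact: a0.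
  rewrite (bigD1 j) //= lerDl; apply: sumr_ge0 => i _; exact: normc_ge0.
apply: ler_sum => j _.
have u : uniq
    [seq mpoly.mnm_sub a (mpoly.mnm1 j) |
      a <- [seq a : mpoly.multinom n <- mpoly.msupp P | (0 < a j)%N]].
  rewrite map_inj_in_uniq ?filter_uniq ?mpoly.msupp_uniq // => a b.
  rewrite !mem_filter => /andP[aj _] /andP[bj _] /mpoly.mnmP E; apply/mpoly.mnmP => i.
  have := E i; rewrite !mpoly.mnmBE mpoly.mnm1E; case: eqP => [<-|_]; last by rewrite !subn0.
  by move: aj bj; lia.
apply: le_trans _ (coef_l1_seq (mpoly.mderiv j P) u).
rewrite [leRHS]big_map big_filter; apply: ler_sum => a aj.
rewrite mpoly.mcoeff_deriv mpoly.submK; last by rewrite mpoly.lep1mP -lt0n.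
by rewrite -mulr_natl Normc.normcM normc_nat ler_peMl ?normc_ge0 // ler1n.
Qed.

Lemma coef_l1_word (k m : nat) P : (k <= m)%N -> homogeneous m P ->
  coef_l1 P <= \sum_(t : k.-tuple 'I_n) coef_l1 (word_deriv t P).
Proof.
elim: k m P => [|k IH] m P km hP.
  by rewrite (big_tuple_nil (fun t => coef_l1 (word_deriv t P))) word_deriv_nil.
case: m km hP => // m km hP.
apply: le_trans (coef_l1_deriv hP) _.
rewrite (big_tuple_cons k (fun t => coef_l1 (word_deriv t P))); apply: ler_sum => j _.
under eq_bigr => t _ do rewrite word_deriv_cons.
by apply: (IH m) => //; exact: homogeneous_deriv hP.
Qed.

(** Enlarging [s] to all exponents below D factors the sum into n truncated geometric series. *)
Lemma sum_weights (r : R) (s : seq (mpoly.multinom n)) : 0 <= r < 1 -> uniq s ->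
  \sum_(a <- s) (r ^+ 2) ^+ mpoly.mdeg a <= ((1 - r ^+ 2)^-1) ^+ n.
Proof.
move=> /andP[r0 r1] us; set x := r ^+ 2.
have x0 : 0 <= x by exact: sqr_ge0.
have x1 : x < 1 by rewrite expr_lt1.
pose D := (\max_(a <- s) mpoly.mdeg a).+1.
have aD a i : a \in s -> (a i < D)%N.
  by move=> sa; rewrite ltnS (leq_trans (mnm_le_mdeg a i)) // leq_bigmax_seq.
pose h (a : mpoly.multinom n) : {ffun 'I_n -> 'I_D} := [ffun i => inord (a i)].
have hE a i : a \in s -> h a i = a i :> nat by move=> sa; rewrite ffunE inordK ?aD.
pose F (f : {ffun 'I_n -> 'I_D}) : R := \prod_(i < n) x ^+ f i.
have F0 f : 0 <= F f by apply: prodr_ge0 => i _; rewrite exprn_ge0.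
have uh : uniq (map h s).
  rewrite map_inj_in_uniq // => a b sa sb /ffunP hab; apply/mpoly.mnmP => i.
  by rewrite -hE // -[RHS]hE // hab.
have -> : \sum_(a <- s) x ^+ mpoly.mdeg a = \sum_(f <- map h s) F f.
  rewrite big_map !big_seq; apply: eq_bigr => a sa.
  by rewrite /F mpoly.mdegE expr_sum; apply: eq_bigr => i _; rewrite hE.
apply: (@le_trans _ _ (\sum_f F f)).
  rewrite big_uniq //= [leRHS](bigID (mem (map h s))) /= lerDl.
  by apply: sumr_ge0.
rewrite /F -(bigA_distr_bigA (fun (i : 'I_n) (j : 'I_D) => x ^+ j)) /=.
rewrite prodr_const card_ord; apply: lerXn2r; rewrite ?nnegrE ?invr_ge0 ?subr_ge0 ?(ltW x1) //.
  by apply: sumr_ge0 => j _; rewrite exprn_ge0.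
rewrite -[leRHS]mul1r ler_pdivlMr ?subr_gt0 // mulrC.
rewrite -[1 - x]opprB mulNr -subrX1 opprB.
by rewrite lerBlDr lerDl exprn_ge0.
Qed.

Lemma coef_l1_l2 (m : nat) (r : R) P : 0 <= r < 1 -> homogeneous m P ->
  coef_l1 P * r ^+ m <= Num.sqrt (((1 - r ^+ 2)^-1) ^+ n) *
   Num.sqrt (\sum_(a <- mpoly.msupp P) normc (mpoly.mcoeff a P) ^+ 2).
Proof.
move=> r01 hP; have /andP[r0 r1] := r01.
have -> : coef_l1 P * r ^+ m =
    \sum_(a <- mpoly.msupp P) r ^+ mpoly.mdeg a * normc (mpoly.mcoeff a P).
  by rewrite /coef_l1 mulrC big_distrr !big_seq; apply: eq_bigr => a /hP ->.
have c0 : 0 <= ((1 - r ^+ 2)^-1) ^+ n.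
  by rewrite exprn_ge0 // invr_ge0 subr_ge0 expr_le1 // ltW.
rewrite -sqrtrM //.
apply: le_trans (ler_norm _) _.
rewrite -sqrtr_sqr; apply: ler_wsqrtr; apply: le_trans (cauchy_schwarz_sum _ _ _) _.
apply: ler_wpM2r; first by apply: sumr_ge0 => a _; exact: sqr_ge0.
apply: le_trans (sum_weights r01 (mpoly.msupp_uniq P)).
by apply: ler_sum => a _; rewrite exprAC.
Qed.

End Derivatives.

(** * Coefficient sums of a homogeneous polynomial *)

Section CoefficientSum.
Variables (R : realType) (n : nat).
Implicit Types P Q : mpoly.mpoly n R[i].

(* Splitting off k.+1 derivatives as a form, to which Bohnenblust--Hille
   applies, and using the near-L2 moment comparison in the remaining ones. *)
Lemma coef_l1_bound (m k : nat) P (B r : R) : (k < m)%N -> homogeneous m P ->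
  (0 < n)%N -> 0 <= r < 1 ->
  (forall z, (forall i, normc (z i) < 1) -> normc (mpoly.meval z P) <= B) ->
  coef_l1 P * r ^+ (m - k.+1) <=
  B * Num.sqrt (((1 - r ^+ 2)^-1) ^+ n) * 2 `^ (m%:R / k.+1%:R) *
  Num.sqrt n%:R ^+ k * (2 ^+ k * expR k.+2%:R * m%:R ^+ k.+1).
Proof.
move=> km hP n0 r01 PB.
have m0 : 0 < m%:R :> R by rewrite ltr0n (leq_trans _ km).
have B0 : 0 <= B.
  by apply: le_trans (normc_ge0 _) (PB (fun=> 0) _) => i; rewrite Normc.normc0.
have PB' y (u : R) : 0 < u -> (forall i, normc (y i) < u) -> normc (mpoly.meval y P) <= u ^+ m * B.
  move=> u0 yu; have uC : u%:C%C != 0 by apply: contraTneq u0 => /RtoC_inj ->; rewrite ltxx.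
  have -> : mpoly.meval y P = mpoly.meval (fun i => u%:C%C * (y i / u%:C%C)) P.
    by apply: mpoly.meval_eq => i; rewrite mulrC divfK.
  rewrite (meval_scale _ _ hP) Normc.normcM normcX normc_real (gtr0_norm u0).
  apply: ler_wpM2l; first by rewrite exprn_ge0 // ltW.
  apply: PB => i.
  by rewrite Normc.normcM Normc.normcV normc_real (gtr0_norm u0) ltr_pdivrMr // mul1r.
(* With radius 1/m for the k+1 Cauchy estimates, P is needed on the polydisk of radius 1 + (k+1)/m,
   and 1/t^(k+1) is m^(k+1). [PB'] speaks of open polydisks, hence k+2, and homogeneity costs (1 +
   (k+2)/m)^m <= e^(k+2). *)
pose H := expR k.+2%:R * B / m%:R^-1 ^+ k.+1.
have H0 : 0 <= H by rewrite !mulr_ge0 ?expR_ge0 // invr_ge0 exprn_ge0 // invr_ge0 ltW.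
pose p : R := 2 * k.+1%:R / k.+2%:R.
have p0 : 0 < p by rewrite divr_gt0 ?mulr_gt0 ?ltr0n.
have BH z : (forall i, normc (z i) = 1) ->
    \sum_(t : k.+1.-tuple 'I_n) normc (mpoly.meval z (word_deriv t P)) `^ p <= (2 ^+ k * H) `^ p.
  move=> z1; apply: (bohnenblust_hille (a := fun s => mpoly.meval z (word_deriv s P))).
    by move=> s t st; rewrite (word_deriv_perm P st).
  move=> ws szws ws1; rewrite /H -[X in _ / _ ^+ X]szws.
  apply: (cauchy_mform (r := 1)).
  - by rewrite invr_gt0.
  - by apply: List.Forall_impl ws1 => v v1 i; rewrite v1.
  - move=> y yr; apply: le_trans (PB' y (1 + k.+2%:R / m%:R) _ _) _.
    + by rewrite addr_gt0 // divr_gt0 // ltr0n.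
    + move=> i; apply: le_lt_trans (yr i) _.
      by rewrite szws ltrD2l ltr_pM2r ?invr_gt0 // ltr_nat.
    + apply: ler_wpM2r => //.
      apply: (@le_trans _ _ (expR (k.+2%:R / m%:R) ^+ m)).
        apply: lerXn2r; rewrite ?nnegrE ?expR_ge0 //; last exact: expR_ge1Dx.
      by rewrite -expRM_natr divfK // gt_eqF.
  - by move=> i; rewrite z1.
pose M := (2 * m).+1.
have [w wM] := @exists_prim_root R M isT.
pose u (t : k.+1.-tuple 'I_n) :=
  torus_mean M w (fun z => normc (mpoly.meval z (word_deriv t P)) `^ p).
have u0 t : 0 <= u t by apply: torus_mean_ge0 => z; exact: powR_ge0.
have usum : \sum_t u t <= (2 ^+ k * H) `^ p.
  rewrite /u -torus_mean_sum -[leRHS](torus_mean_cst n w (isT : (0 < M)%N)).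
  by apply: torus_mean_le => // z z1; exact: BH.
have hw (t : k.+1.-tuple 'I_n) : homogeneous (m - k.+1) (word_deriv t P).
  by have := homogeneous_word (s := t) hP; rewrite size_tuple.
have wdeg (t : k.+1.-tuple 'I_n) a : a \in mpoly.msupp (word_deriv t P) -> (mpoly.mdeg a <= m)%N.
  by move=> /hw ->; exact: leq_subr.
have step (t : k.+1.-tuple 'I_n) : coef_l1 (word_deriv t P) * r ^+ (m - k.+1) <=
    Num.sqrt (((1 - r ^+ 2)^-1) ^+ n) * (2 `^ (m%:R / k.+1%:R) * u t `^ p^-1).
  apply: le_trans (coef_l1_l2 r01 (hw t)) _; apply: ler_wpM2l; first exact: sqrtr_ge0.
  have mM : (2 * m < M)%N by [].
  rewrite -(parseval_mpoly (isT : (0 < M)%N) wM); last first.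
    by move=> a /(wdeg t) am; rewrite ltnS mul2n -addnn (leq_trans am) ?leq_addr.
  apply: le_trans (torus_mean_low k mM wM (wdeg t)) _.
  by rewrite /u /p invf_div.
(* Hoelder over the n^(k+1) words, with 1 - 1/p = k/(2(k+1)), gives n^(k/2). For k = 0 this weight
   is 0, outside the range of [hoelder_sum], but then p = 1. *)
have usum' : \sum_t u t `^ p^-1 <= Num.sqrt n%:R ^+ k * (2 ^+ k * H).
  have kH0 : 0 <= 2 ^+ k * H by rewrite mulr_ge0 ?exprn_ge0.
  have -> : 2 ^+ k * H = ((2 ^+ k * H) `^ p) `^ p^-1.
    by rewrite -powRrM divff ?gt_eqF // powRr1.
  apply: (@le_trans _ _ (Num.sqrt n%:R ^+ k * (\sum_t u t) `^ p^-1)); last first.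
    apply: ler_wpM2l; first by rewrite exprn_ge0 ?sqrtr_ge0.
    by apply: ler_powR2 => //; [rewrite invr_ge0 ltW|apply: sumr_ge0].
  have [k0|k0] := posnP k.
    have -> : p = 1 by rewrite /p k0 mulr1 divff.
    rewrite invr1 powRr1; last exact: sumr_ge0.
    have -> : Num.sqrt n%:R ^+ k = 1 :> R by rewrite k0.
    rewrite mul1r; apply: ler_sum => t _.
    by rewrite powRr1.
  have K0 : 0 < k%:R :> R by rewrite ltr0n.
  have v0 : 0 < k%:R / (2 * k.+1%:R) :> R by rewrite divr_gt0 ?mulr_gt0 ?ltr0n.
  have pi0 : 0 < p^-1 by rewrite invr_gt0.
  have pv : p^-1 + k%:R / (2 * k.+1%:R) = 1.
    rewrite /p invf_div -mulrDl -natrD; have -> : (k.+2 + k = 2 * k.+1)%N by lia.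
    by rewrite natrM divff // mulf_neq0 // pnatr_eq0.
  have := hoelder_sum (index_enum {: k.+1.-tuple 'I_n}) pi0 v0 pv u0 (fun=> ler01).
  under eq_bigr => t _ do rewrite powR1 mulr1.
  move=> h; apply: le_trans h _; rewrite mulrC; apply: ler_wpM2r; first exact: powR_ge0.
  rewrite sumr_const card_tuple card_ord natrX -powR_mulrn // -powRrM.
  have -> : k.+1%:R * (k%:R / (2 * k.+1%:R)) = 2^-1 * k%:R :> R.
    have k1 : k.+1%:R != 0 :> R by rewrite pnatr_eq0.
    by move: (k.+1%:R : R) k1 => K1 k1; field.
  by rewrite powRrM powR12_sqrt // powR_mulrn // sqrtr_ge0.
apply: (@le_trans _ _ (\sum_(t : k.+1.-tuple 'I_n) coef_l1 (word_deriv t P) * r ^+ (m - k.+1))).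
  rewrite -big_distrl /=; apply: ler_wpM2r; last exact: (coef_l1_word km hP).
  by case/andP: r01 => r0 _; rewrite exprn_ge0.
apply: le_trans (ler_sum _ (fun t _ => step t)) _.
rewrite -!big_distrr /=.
apply: (@le_trans _ _ (Num.sqrt (((1 - r ^+ 2)^-1) ^+ n) *
   (2 `^ (m%:R / k.+1%:R) * (Num.sqrt n%:R ^+ k * (2 ^+ k * H))))).
  apply: ler_wpM2l; first exact: sqrtr_ge0.
  by apply: ler_wpM2l; first exact: powR_ge0.
rewrite /H [m%:R^-1 ^+ _]exprVn invrK le_eqVlt; apply/orP; left; apply/eqP; ring.
Qed.

End CoefficientSum.

(** * Asymptotics of the coefficient sums *)

Section Asymptotics.
Variable R : realType.

Lemma nat_above (x : R) : exists N : nat, x <= N%:R.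
Proof.
exists (Num.bound `|x|); apply: le_trans (ler_norm x) _.
by apply: ltW; apply: archi_boundP.
Qed.

Lemma ln_nat_above (A : R) : exists N : nat, forall n, (N <= n)%N -> (0 < n)%N && (A <= ln n%:R).
Proof.
have [N NA] := nat_above (expR A); exists N.+1 => n Nn.
have n0 : (0 < n)%N by exact: leq_trans Nn.
rewrite n0 /= -[A]expRK ler_ln ?posrE ?expR_gt0 ?ltr0n //.
by apply: le_trans NA _; rewrite ler_nat ltnW.
Qed.

Lemma pow_le_expR (D : nat) (h : R) : 0 < h ->
  exists2 C, 0 < C & forall x, 0 <= x -> x ^+ D <= C * expR (h * x).
Proof.
move=> h0; case: D => [|D].
  exists 1 => // x x0; rewrite expr0 mul1r -expR0 ler_expR.
  by rewrite mulr_ge0 // ltW.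
exists ((D.+1)`!%:R / h ^+ D.+1) => [|x x0].
  by rewrite divr_gt0 ?exprn_gt0 // ltr0n fact_gt0.
have hx : 0 <= h * x by rewrite mulr_ge0 // ltW.
have f0 : 0 < (D.+1)`!%:R :> R by rewrite ltr0n fact_gt0.
rewrite mulrAC ler_pdivlMr ?exprn_gt0 // mulrC -exprMn -ler_pdivrMl // mulrC.
by apply: le_trans _ (expR_ge1Dxn D hx); rewrite lerDr.
Qed.

Lemma geometric_sum_le (x : R) (T : nat) : 0 <= x < 1 ->
  \sum_(m < T) x ^+ m <= (1 - x)^-1.
Proof.
move=> /andP[x0 x1]; rewrite -[leRHS]mul1r ler_pdivlMr ?subr_gt0 // mulrC.
rewrite -[1 - x]opprB mulNr -subrX1 opprB.
by rewrite lerBlDr lerDl exprn_ge0.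
Qed.

(** Half of the decay, in s = exp(-h)^2, absorbs m^D and the other half is a geometric series. *)
Lemma sum_pow_geometric (D : nat) (s : R) : 0 < s < 1 ->
  exists2 C, 0 < C & forall T, \sum_(m < T) m%:R ^+ D * s ^+ m <= C.
Proof.
move=> /andP[s0 s1].
pose h := - ln s / 2.
have h0 : 0 < h by rewrite divr_gt0 // oppr_gt0 ln_lt0 // s0.
have sE : s = expR (- h) ^+ 2.
  rewrite -expRM_natr mulNr divfK // opprK lnK //.
have [C C0 CP] := @pow_le_expR D h h0.
have e01 : 0 <= expR (- h) < 1 by rewrite expR_ge0 expR_lt1 oppr_lt0.
exists (C * (1 - expR (- h))^-1).
  by rewrite mulr_gt0 // invr_gt0 subr_gt0; case/andP: e01.
move=> T; apply: le_trans (ler_wpM2l (ltW C0) (geometric_sum_le T e01)).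
rewrite big_distrr /=; apply: ler_sum => m _.
apply: (@le_trans _ _ (C * expR (h * m%:R) * s ^+ m)).
  by rewrite ler_wpM2r ?CP // exprn_ge0 // ltW.
rewrite -mulrA; apply: ler_wpM2l; first exact: ltW.
rewrite sE -!expRM_natr -expRD ler_expR le_eqVlt; apply/orP; left; apply/eqP; ring.
Qed.

Lemma expR_ln_nat (n : nat) : (0 < n)%N -> expR (ln n%:R) = n%:R :> R.
Proof. by move=> n0; rewrite lnK // posrE ltr0n. Qed.

Lemma sqrt_expR (x : R) : Num.sqrt (expR x) = expR (x / 2).
Proof.
have {1}-> : x = x / 2 * 2%:R by rewrite divfK.
by rewrite expRM_natr sqrtr_sqr ger0_norm // expR_ge0.
Qed.

(** With L = log n this is L^2/2 <= e^L; it gives the decay of log n / n with an explicit rate. *)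
Lemma ln_div_le (n : nat) : (0 < n)%N -> 0 < ln (n%:R : R) -> ln n%:R / n%:R <= 2 / ln n%:R :> R.
Proof.
move=> n0 L0; rewrite ler_pdivrMr ?ltr0n // mulrAC ler_pdivlMr // -expr2.
rewrite -{2}(expR_ln_nat n0) -ler_pdivrMl // mulrC.
by apply: le_trans _ (expR_ge1Dxn 1 (ltW L0)); rewrite lerDr.
Qed.

Lemma inv_onem_exp_le (x : R) (n : nat) : 0 <= x < 1 ->
  ((1 - x)^-1) ^+ n <= expR (n%:R * x / (1 - x)).
Proof.
move=> /andP[x0 x1]; have y0 : 0 < 1 - x by rewrite subr_gt0.
rewrite -mulrA expRM_natl; apply: lerXn2r; rewrite ?nnegrE ?expR_ge0 ?invr_ge0 ?(ltW y0) //.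
apply: le_trans _ (expR_ge1Dx _).
by rewrite le_eqVlt; apply/orP; left; apply/eqP; field; rewrite gt_eqF.
Qed.

(* With the weight s^2 sqrt(log n / n) the factor (1 - r^2)^(-n/2) is at most
   n^(s^2/2), which loses against the n^(-1/2) gained from Bohnenblust--Hille. *)
Lemma coef_sum_small (s e : R) : 0 < s < 1 -> 0 < e ->
  exists N : nat, forall n, (N <= n)%N ->
  forall (P : nat -> mpoly.mpoly n R[i]) (B : R),
  (forall m, homogeneous m (P m)) ->
  (forall m z, (0 < m)%N -> (forall i, normc (z i) < 1) -> normc (mpoly.meval z (P m)) <= B) ->
  forall T, \sum_(m < T | (0 < m)%N)
    coef_l1 (P m) * (s ^+ 4 * Num.sqrt (ln n%:R / n%:R)) ^+ m <= e * B.
Proof.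
move=> /andP[s0 s1] e0.
(* This says 2^(1/(k0+1)) <= 1/s: the loss 2^(m/(k0+1)) is then at most s^(-m). *)
have [k0 k0P] : exists k, 2 <= s^-1 ^+ k.+1.
  have a0 : 0 < - ln s by rewrite oppr_gt0 ln_lt0 // s0.
  have [k kP] := nat_above (- ln s)^-1; exists k.
  have -> : s^-1 = expR (- ln s) by rewrite expRN lnK.
  rewrite -expRM_natr; apply: le_trans _ (expR_ge1Dx _).
  rewrite -[2]/(1 + 1) lerD2l; apply: (@le_trans _ _ (- ln s * k%:R)).
    by rewrite -ler_pdivrMl // mulr1.
  by rewrite ler_wpM2l ?ler_nat // ltW.
pose D := k0.+1.
have s01 : 0 < s < 1 by rewrite s0.
have [C2 C20 C2P] := @sum_pow_geometric D s s01.
pose c : R := (1 - s ^+ 2) / 2.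
have c0 : 0 < c by rewrite divr_gt0 // subr_gt0 expr_lt1 // ltW.
have c20 : 0 < c / 2 by rewrite divr_gt0.
have [C3 C30 C3P] := @pow_le_expR D (c / 2) c20.
pose C1 : R := 2 * s ^- (2 * D) * (2 ^+ k0 * expR k0.+2%:R).
have C10 : 0 < C1 by rewrite !mulr_gt0 ?invr_gt0 ?exprn_gt0 ?expR_gt0.
pose C4 := C1 * C2 * C3.
have C40 : 0 < C4 by apply: mulr_gt0 C30; apply: mulr_gt0 C20.
(* L >= A gives L >= 1, then log n / n <= 2/L <= 1 - s^2, and also c L / 2 >= C4 / e, so that C4
   exp(-c L / 2) <= e. *)
pose A := 1 + 2 * (C4 / e) / c + 2 / (1 - s ^+ 2).
have s20 : 0 < 1 - s ^+ 2 by rewrite subr_gt0 expr_lt1 // ltW.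
have t1 : 0 <= 2 * (C4 / e) / c by rewrite ltW // divr_gt0 // mulr_gt0 // divr_gt0.
have t2 : 0 <= 2 / (1 - s ^+ 2) by rewrite divr_ge0 // ltW.
have [N NP] := ln_nat_above A; exists N => n Nn P B hP PB T.
have /andP[n0 LA] := NP n Nn; set L := ln n%:R in LA *.
have L1 : 1 <= L by apply: le_trans LA; rewrite /A -addrA lerDl addr_ge0.
have L0 : 0 < L by exact: lt_le_trans L1.
have nR : 0 < n%:R :> R by rewrite ltr0n.
have B0 : 0 <= B.
  apply: le_trans (normc_ge0 _) (PB 1%N (fun=> 0) isT _) => i.
  by rewrite Normc.normc0.
pose r := s ^+ 2 * Num.sqrt (L / n%:R).
have r0 : 0 <= r by rewrite mulr_ge0 ?sqrtr_ge0 // sqr_ge0.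
have r2 : r ^+ 2 = s ^+ 4 * (L / n%:R).
  by rewrite exprMn -exprM sqr_sqrtr // divr_ge0 // ltW.
have x1 : L / n%:R <= 1 - s ^+ 2.
  apply: le_trans (ln_div_le n0 L0) _.
  rewrite ler_pdivrMr // mulrC -ler_pdivrMr //.
  by apply: le_trans LA; rewrite /A lerDr addr_ge0.
have r2s : r ^+ 2 <= 1 - s ^+ 2.
  rewrite r2; apply: le_trans x1; rewrite ler_piMl ?divr_ge0 ?(ltW L0) //.
  by rewrite exprn_ile1 // ltW.
have r21 : 0 <= r ^+ 2 < 1.
  by rewrite sqr_ge0 /= (le_lt_trans r2s) // ltrBlDr ltrDl exprn_gt0.
have r01 : 0 <= r < 1.
  by rewrite r0 /=; case/andP: r21 => _; rewrite expr_lt1.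
(* n r^2 / (1 - r^2) = s^4 L / (1 - r^2), and 1 - r^2 >= s^2 uses up two of the four powers of s. *)
have S_le : Num.sqrt (((1 - r ^+ 2)^-1) ^+ n) <= expR (s ^+ 2 * L / 2).
  rewrite -sqrt_expR; apply: ler_wsqrtr; apply: le_trans (inv_onem_exp_le n r21) _.
  rewrite ler_expR r2 ler_pdivrMr; last first.
    by rewrite subr_gt0 -r2; case/andP: r21.
  have -> : n%:R * (s ^+ 4 * (L / n%:R)) = s ^+ 4 * L by field; rewrite gt_eqF.
  rewrite -r2 [leRHS]mulrAC; apply: ler_wpM2r; first exact: ltW.
  rewrite -[4%N]/(2 + 2)%N exprD.
  rewrite ler_wpM2l ?sqr_ge0 //.
  by rewrite lerBrDr addrC -lerBrDr.
have sqn : Num.sqrt n%:R = expR (L / 2) by rewrite -sqrt_expR /L expR_ln_nat.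
set S := Num.sqrt (((1 - r ^+ 2)^-1) ^+ n) in S_le.
have S0 : 0 <= S by exact: sqrtr_ge0.
set y := s ^+ 4 * _.
have y0 : 0 <= y by rewrite mulr_ge0 ?sqrtr_ge0 // exprn_ge0 // ltW.
(* These two powers of s per degree are what remains to pay for 2^(m/k) and to sum over m. *)
have yr : y = s ^+ 2 * r by rewrite /y /r mulrA -exprD.
have sq0 : 0 < Num.sqrt n%:R :> R by rewrite sqrtr_gt0.
have ysn : y * Num.sqrt n%:R <= L.
  rewrite /y -mulrA -sqrtrM ?divr_ge0 ?(ltW L0) // divfK ?gt_eqF //.
  apply: (@le_trans _ _ (Num.sqrt L)).
    by rewrite ler_piMl ?sqrtr_ge0 // exprn_ile1 // ltW.
  rewrite -[leRHS]ger0_norm ?(ltW L0) // -sqrtr_sqr; apply: ler_wsqrtr.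
  by rewrite expr2 ler_peMl // ltW.
clearbody y.
have term (m : nat) : (0 < m)%N ->
    coef_l1 (P m) * y ^+ m <= (B * (S / Num.sqrt n%:R * L ^+ D) * C1) * (m%:R ^+ D * s ^+ m).
  (* A degree m <= k0 does not allow k0+1 derivatives; then all m are taken, k+1 = m, and no factor
     r remains. *)
  move=> m0; pose k := minn k0 m.-1.
  have km : (k < m)%N by rewrite -[m]prednK // ltnS geq_minr.
  have kD : (k < D)%N by rewrite ltnS geq_minl.
  have -> : coef_l1 (P m) * y ^+ m =
      (y ^+ k.+1 * (s ^+ 2) ^+ (m - k.+1)) * (coef_l1 (P m) * r ^+ (m - k.+1)).
    have -> : y ^+ m = y ^+ k.+1 * y ^+ (m - k.+1) by rewrite -exprD subnKC.
    by rewrite [X in _ * (_ * X ^+ _)]yr exprMn; ring.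
  apply: le_trans (ler_wpM2l _ (coef_l1_bound km (hP m) n0 r01 (fun z => PB m z m0))) _.
    by rewrite mulr_ge0 // exprn_ge0 // sqr_ge0.
  (* There are k+1 factors y against k factors sqrt n; the unmatched one is the gain of n^(-1/2). *)
  have yk : y ^+ k.+1 * Num.sqrt n%:R ^+ k <= L ^+ D / Num.sqrt n%:R.
    rewrite ler_pdivlMr // -mulrA -exprSr -exprMn.
    apply: (@le_trans _ _ (L ^+ k.+1)).
      by apply: lerXn2r; rewrite ?nnegrE ?(ltW L0) // mulr_ge0 // ltW.
    by apply: ler_weXn2l.
  have ss : (s ^+ 2) ^+ (m - k.+1) * 2 `^ (m%:R / k.+1%:R) <= 2 * s ^- (2 * D) * s ^+ m.
    have sD0 : 0 < s ^+ (2 * D) by rewrite exprn_gt0.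
    have [kk0|kk0] := leqP k0 m.-1.
      have kE : k = k0 by exact/minn_idPl.
      have p2 : 2 `^ (m%:R / k.+1%:R) <= s^-1 ^+ m.
        rewrite kE mulrC powRrM; apply: (@le_trans _ _ (s^-1 `^ m%:R)); last first.
          by rewrite powR_mulrn // invr_ge0 ltW.
        apply: ler_powR2; [by []|exact: powR_ge0|].
        have -> : s^-1 = (s^-1 ^+ k0.+1) `^ k0.+1%:R^-1.
          rewrite -powR_mulrn ?invr_ge0 ?(ltW s0) // -powRrM divff ?pnatr_eq0 //.
          by rewrite powRr1 // invr_ge0 ltW.
        by apply: ler_powR2.
      apply: le_trans (ler_wpM2l _ p2) _; first by rewrite exprn_ge0 // sqr_ge0.
      have E : (s ^+ 2) ^+ (m - k.+1) * s ^+ (2 * D) = s ^+ m * s ^+ m.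
        rewrite -exprM -!exprD -mulnDr; move: km; rewrite kE /D => km.
        by rewrite subnK // mul2n addnn.
      have -> : (s ^+ 2) ^+ (m - k.+1) * s^-1 ^+ m = s ^- (2 * D) * s ^+ m.
        have sm0 : s ^+ m != 0 by rewrite expf_neq0 // gt_eqF.
        rewrite exprVn; apply: (mulIf sm0); rewrite divfK //.
        by rewrite -mulrA -E mulrC mulfK // gt_eqF.
      by rewrite -mulrA ler_peMl ?mulr_ge0 ?invr_ge0 ?exprn_ge0 ?(ltW s0) // ler1n.
    have kE : k.+1 = m by rewrite /k (minn_idPr (ltnW kk0)) prednK.
    rewrite kE subnn expr0 mul1r divff ?pnatr_eq0 -?lt0n // powRr1 //.
    rewrite -mulrA ler_peMr // mulrC ler_pdivlMr // mul1r.
    apply: ler_wiXn2l; rewrite ?ltW //.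
    by rewrite /D (leq_trans _ (leq_pmull _ _)) // -(prednK m0) ltnS ltnW // ltnW.
  have mk : 2 ^+ k * expR k.+2%:R * m%:R ^+ k.+1 <= 2 ^+ k0 * expR k0.+2%:R * m%:R ^+ D :> R.
    apply: ler_pM; rewrite ?mulr_ge0 ?exprn_ge0 ?expR_ge0 //.
      apply: ler_pM; rewrite ?exprn_ge0 ?expR_ge0 //.
        by apply: ler_weXn2l; rewrite ?ler1n.
      by rewrite ler_expR ler_nat.
    by apply: ler_weXn2l; rewrite ?ler1n.
  pose Z := 2 ^+ k * expR k.+2%:R * m%:R ^+ k.+1 : R.
  have Z0 : 0 <= Z by rewrite !mulr_ge0 ?exprn_ge0 ?expR_ge0.
  have -> : y ^+ k.+1 * (s ^+ 2) ^+ (m - k.+1) *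
     (B * S * 2 `^ (m%:R / k.+1%:R) * Num.sqrt n%:R ^+ k * Z) =
     B * S * (y ^+ k.+1 * Num.sqrt n%:R ^+ k) *
     (((s ^+ 2) ^+ (m - k.+1) * 2 `^ (m%:R / k.+1%:R)) * Z) by ring.
  have -> : B * (S / Num.sqrt n%:R * L ^+ D) * C1 * (m%:R ^+ D * s ^+ m) =
     B * S * (L ^+ D / Num.sqrt n%:R) *
     ((2 * s ^- (2 * D) * s ^+ m) * (2 ^+ k0 * expR k0.+2%:R * m%:R ^+ D)).
    rewrite /C1; ring.
  apply: ler_pM.
  - by rewrite !mulr_ge0 // ?exprn_ge0 // ltW.
  - by apply: mulr_ge0 Z0; rewrite mulr_ge0 ?powR_ge0 // exprn_ge0 // sqr_ge0.
  - by apply: ler_wpM2l => //; rewrite mulr_ge0.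
  apply: ler_pM => //; first by rewrite mulr_ge0 ?powR_ge0 // exprn_ge0 // sqr_ge0.
apply: (@le_trans _ _ (\sum_(m < T | (0 < m)%N)
    (B * (S / Num.sqrt n%:R * L ^+ D) * C1) * (m%:R ^+ D * s ^+ m))).
  by apply: ler_sum => m; exact: term.
rewrite -big_distrr /=.
have fac0 : 0 <= B * (S / Num.sqrt n%:R * L ^+ D) * C1.
  apply: mulr_ge0 (ltW C10); apply: mulr_ge0 => //; apply: mulr_ge0.
    by rewrite divr_ge0 ?sqrtr_ge0.
  by rewrite exprn_ge0 // ltW.
apply: (@le_trans _ _ (B * (S / Num.sqrt n%:R * L ^+ D) * C1 * C2)).
  apply: ler_wpM2l => //; apply: le_trans _ (C2P T).
  rewrite big_mkcond /=; apply: ler_sum => m _; case: ifP => // _.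
  by rewrite mulr_ge0 ?exprn_ge0 // ltW.
(* S / sqrt n is at most n^(-c), by the choice of c; half of this exponent absorbs the power of log
   n. *)
have SL : S / Num.sqrt n%:R * L ^+ D <= C3 * expR (- (c / 2 * L)).
  apply: (@le_trans _ _ (expR (- (c * L)) * (C3 * expR (c / 2 * L)))).
    apply: ler_pM; rewrite ?exprn_ge0 ?(ltW L0) //.
      by rewrite divr_ge0 ?sqrtr_ge0.
      rewrite sqn ler_pdivrMr ?expR_gt0 // -expRD; apply: le_trans S_le _.
      by rewrite ler_expR le_eqVlt; apply/orP; left; apply/eqP; rewrite /c; field.
    by apply: C3P; exact: ltW.
  rewrite mulrCA -expRD ler_wpM2l ?(ltW C30) // ler_expR.
  by rewrite le_eqVlt; apply/orP; left; apply/eqP; field.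
have C4e : C4 * expR (- (c / 2 * L)) <= e.
  rewrite expRN -ler_pdivlMr ?invr_gt0 ?expR_gt0 // invrK mulrC -ler_pdivrMr //.
  apply: le_trans _ (expR_ge1Dx _).
  have : 2 * (C4 / e) / c <= L.
    by apply: le_trans LA; rewrite /A addrAC lerDr addr_ge0.
  rewrite ler_pdivrMr // => h; apply: (@le_trans _ _ (c / 2 * L)); last by rewrite lerDr.
  have -> : c / 2 * L = L * c / 2 by ring.
  by rewrite ler_pdivlMr // mulrC.
apply: (@le_trans _ _ (B * (C4 * expR (- (c / 2 * L))))).
  have -> : B * (C4 * expR (- (c / 2 * L))) = B * (C3 * expR (- (c / 2 * L))) * C1 * C2.
    by rewrite /C4; ring.
  apply: ler_wpM2r; first exact: ltW.
  by apply: ler_wpM2r; [exact: ltW|apply: ler_wpM2l].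
by rewrite mulrC; apply: ler_wpM2r.
Qed.

End Asymptotics.

(** * Random sign polynomials *)

Section RandomSigns.
Variable R : realType.

(** Only the order t^2 of the exponent matters later, and the constant 2 allows a short proof: for t
    > 1/2 one has t <= 2 t^2, otherwise e^t <= 1/(1-t) and e^(-t) <= 1/(1+t). *)
Lemma expR_sym_le (t : R) : expR t + expR (- t) <= 2 * expR (2 * t ^+ 2).
Proof.
wlog t0 : t / 0 <= t.
  move=> W; have [/W//|/ltW t0] := leP 0 t.
  by have := W (- t); rewrite oppr_ge0 opprK sqrrN addrC; exact.
have [th|th] := leP (2 * t) 1; last first.
  have le1 : expR (- t) <= expR t by rewrite ler_expR; lra.
  apply: (@le_trans _ _ (2 * expR t)); first by rewrite mulr_natl mulr2n lerD2l.
  rewrite ler_wpM2l // ler_expR -subr_ge0.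
  have -> : 2 * t ^+ 2 - t = t * (2 * t - 1) by ring.
  by rewrite mulr_ge0 // subr_ge0 ltW.
have inv_le (a b : R) : 0 < a -> a <= b -> b^-1 <= a^-1.
  by move=> a0 ab; rewrite lef_pV2 ?posrE // (lt_le_trans a0).
have b1 : 0 < 1 - t by lra.
have b2 : 0 < 1 + t by lra.
have a1 : expR t <= (1 - t)^-1.
  have -> : expR t = (expR (- t))^-1 by rewrite expRN invrK.
  exact: inv_le (expR_ge1Dx _).
have a2 : expR (- t) <= (1 + t)^-1 by rewrite expRN; exact: inv_le (expR_ge1Dx _).
apply: le_trans (lerD a1 a2) _.
apply: (@le_trans _ _ (2 * (1 + 2 * t ^+ 2))); last first.
  by rewrite ler_wpM2l // expR_ge1Dx.
have -> : (1 - t)^-1 + (1 + t)^-1 = 2 / ((1 - t) * (1 + t)).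
  by field; rewrite !gt_eqF.
rewrite ler_pdivrMr ?mulr_gt0 // -subr_ge0.
have -> : 2 * (1 + 2 * t ^+ 2) * ((1 - t) * (1 + t)) - 2 = 2 * t ^+ 2 * (1 - 2 * t ^+ 2) by ring.
have t1 : (2 * t) ^+ 2 <= 1 by rewrite expr_le1 // mulr_ge0.
by rewrite mulr_ge0 ?mulr_ge0 ?sqr_ge0 // subr_ge0; move: t1; rewrite exprMn; lra.
Qed.

Lemma expR_sum (I : Type) (s : seq I) (F : I -> R) :
  expR (\sum_(i <- s) F i) = \prod_(i <- s) expR (F i).
Proof. exact: (big_morph expR (@expRD R) (expR0 R)). Qed.

Definition sgnb (b : bool) : R := (-1) ^+ b.

Lemma rademacher_mgf (T : finType) (t : T -> R) :
  \sum_(e : {ffun T -> bool}) expR (\sum_x sgnb (e x) * t x) <=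
  #|{ffun T -> bool}|%:R * expR (2 * \sum_x t x ^+ 2).
Proof.
under eq_bigr => e _ do rewrite expR_sum.
rewrite -(bigA_distr_bigA (fun (x : T) (b : bool) => expR (sgnb b * t x))) /=.
rewrite big_distrr /= expR_sum card_ffun card_bool natrX -prodr_const -big_split /=.
apply: ler_prod => x _; rewrite big_bool /= /sgnb expr1 expr0 mulN1r mul1r addrC.
by rewrite addr_ge0 ?expR_ge0 // expR_sym_le.
Qed.

(* One sign pattern makes all the sums indexed by J small: Markov's inequality
   for the exponential moments, summed over J. *)
Lemma rademacher_max (T J : finType) (t : J -> T -> R) (V A : R) : 0 < V -> 0 < A ->
  (forall j, \sum_x t j x ^+ 2 <= V) -> 2 * #|J|%:R <= expR A ->
  exists e : {ffun T -> bool}, forall j,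
    `|\sum_x sgnb (e x) * t j x| <= 3 * Num.sqrt (A * V).
Proof.
(* l^2 V = A makes each exponential moment at most e^(2A). The 2|J| terms, from J and both signs,
   cost e^A more, and l |X| <= 3A gives 3 sqrt(A V). *)
move=> V0 A0 tV JA; pose l := Num.sqrt (A / V).
have l0 : 0 < l by rewrite sqrtr_gt0 divr_gt0.
have l2 : l ^+ 2 * V = A by rewrite sqr_sqrtr ?divr_ge0 ?ltW // divfK ?gt_eqF.
pose X (e : {ffun T -> bool}) j := \sum_x sgnb (e x) * t j x.
pose Y (e : {ffun T -> bool}) := \sum_j (expR (l * X e j) + expR (- (l * X e j))).
have mgf (s : R) : s ^+ 2 = 1 ->
    \sum_e \sum_j expR (s * (l * X e j)) <=
    #|{ffun T -> bool}|%:R * (#|J|%:R * expR (2 * A)).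
  move=> s1; rewrite exchange_big /=.
  apply: (@le_trans _ _ (\sum_(j : J) #|{ffun T -> bool}|%:R * expR (2 * A))).
    apply: ler_sum => j _.
    have := rademacher_mgf (fun x => s * l * t j x).
    have -> : \sum_(e : {ffun T -> bool}) expR (\sum_x sgnb (e x) * (s * l * t j x)) =
              \sum_e expR (s * (l * X e j)).
      apply: eq_bigr => e _; congr expR; rewrite /X !big_distrr /=.
      by apply: eq_bigr => x _; ring.
    move/le_trans; apply; apply: ler_wpM2l => //; rewrite ler_expR ler_wpM2l //.
    rewrite -l2; under eq_bigr => x _ do rewrite exprMn.
    by rewrite -big_distrr /= exprMn s1 mul1r ler_wpM2l ?sqr_ge0.
  by rewrite sumr_const -[leLHS]mulr_natl mulrCA; exact: lexx.
have cT : 0 < #|{ffun T -> bool}|%:R :> R by rewrite ltr0n card_ffun card_bool expn_gt0.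
have sumY : \sum_e Y e <= #|{ffun T -> bool}|%:R * expR (3 * A).
  have -> : \sum_e Y e = \sum_e \sum_j expR (1 * (l * X e j)) + \sum_e \sum_j expR (-1 * (l * X e j)).
    rewrite -big_split; apply: eq_bigr => e _; rewrite -big_split; apply: eq_bigr => j _ /=.
    by rewrite mul1r mulN1r.
  apply: le_trans (lerD (mgf 1 _) (mgf (-1) _)) _; rewrite ?sqrrN ?expr1n //.
  rewrite -mulrDr ler_wpM2l //.
  have -> : 3 * A = A + 2 * A by ring.
  have -> : #|J|%:R * expR (2 * A) + #|J|%:R * expR (2 * A) = 2 * #|J|%:R * expR (2 * A) by ring.
  by rewrite expRD ler_wpM2r ?expR_ge0.
have [e Ye] : exists e, Y e <= expR (3 * A).
  apply/existsP; apply: contraTT (sumY); rewrite -ltNge => /existsPn Ye.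
  rewrite mulr_natl -sumr_const; apply: ltr_sum; last by move=> e _; rewrite ltNge.
  apply/hasP; exists [ffun=> true] => //; exact: mem_index_enum.
exists e => j.
have eX : expR (l * `|X e j|) <= expR (3 * A).
  apply: le_trans Ye; rewrite /Y (bigD1 j) //=.
  apply: (@le_trans _ _ (expR (l * X e j) + expR (- (l * X e j)))); last first.
    by rewrite lerDl sumr_ge0 // => i _; rewrite addr_ge0 ?expR_ge0.
  have [X0|X0] := leP 0 (X e j); first by rewrite ger0_norm // lerDl expR_ge0.
  by rewrite ltr0_norm // mulrN lerDr expR_ge0.
move: eX; rewrite ler_expR -/(X e j) => eX.
have -> : Num.sqrt (A * V) = A / l.
  apply/eqP; rewrite -(eqrXn2 (n := 2)) ?sqrtr_ge0 ?divr_ge0 ?(ltW A0) ?(ltW l0) //.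
  rewrite sqr_sqrtr ?mulr_ge0 ?(ltW A0) ?(ltW V0) // expr_div_n sqr_sqrtr ?divr_ge0 ?(ltW A0) ?(ltW V0) //.
  by apply/eqP; field; rewrite !gt_eqF.
by rewrite mulrA ler_pdivlMr // mulrC.
Qed.

End RandomSigns.

(** * Multi-affine functions on nets and random sign polynomials *)

Section RandomPolynomial.
Variable R : realType.

Lemma normc_le_ReIm (z : R[i]) : normc z <= `|complex.Re z| + `|complex.Im z|.
Proof.
case: z => a b /=; rewrite -[leRHS]ger0_norm ?addr_ge0 // -sqrtr_sqr.
apply: ler_wsqrtr; rewrite sqrrD !real_normK ?num_real //.
by rewrite addrAC lerDl mulrn_wge0 // mulr_ge0.
Qed.

Lemma Re_le_normc (z : R[i]) : `|complex.Re z| <= normc z.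
Proof.
by case: z => a b /=; rewrite -sqrtr_sqr; apply: ler_wsqrtr; rewrite lerDl sqr_ge0.
Qed.

Lemma Im_le_normc (z : R[i]) : `|complex.Im z| <= normc z.
Proof.
by case: z => a b /=; rewrite -sqrtr_sqr; apply: ler_wsqrtr; rewrite lerDr sqr_ge0.
Qed.

(** Rounding is towards 0, so that absolute values do not grow and the net for the circle stays in
    the closed disk. *)
Lemma grid_approx (K : nat) (x : R) : (0 < K)%N -> `|x| <= 1 ->
  exists (b : bool) (a : 'I_K.+1),
    `|x - sgnb R b * (a%:R / K%:R)| <= K%:R^-1 /\ `|sgnb R b * (a%:R / K%:R)| <= `|x|.
Proof.
move=> K0 x1; have KR : 0 < K%:R :> R by rewrite ltr0n.
have y0 : 0 <= `|x| * K%:R by rewrite mulr_ge0 // ltW.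
have := truncn_itv y0; set a := Num.truncn _ => /andP[a1 a2].
have aK : (a < K.+1)%N.
  by rewrite ltnS -(ler_nat R) (le_trans a1) // ler_piMl // ltW.
exists (x < 0), (Ordinal aK) => /=.
have xE : x = sgnb R (x < 0) * `|x| by rewrite /sgnb -numEsign.
have sn : `|sgnb R (x < 0)| = 1 by rewrite /sgnb normr_sign.
have q1 : a%:R / K%:R <= `|x| by rewrite ler_pdivrMr.
have q2 : `|x| - a%:R / K%:R <= K%:R^-1.
  have E : K%:R^-1 + a%:R / K%:R = a.+1%:R / K%:R :> R by rewrite -natr1 mulrDl mul1r addrC.
  by rewrite lerBlDr E ler_pdivlMr //; exact: ltW.
rewrite {1}xE -mulrBr ![`|sgnb _ _ * _|]normrM sn !mul1r; split.
  by rewrite ger0_norm // subr_ge0.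
by rewrite ger0_norm // divr_ge0.
Qed.

Lemma unit_circle_net (e : R) : 0 < e ->
  exists (G : finType) (g : G -> R[i]), (forall x, normc (g x) <= 1) /\
    (forall u, normc u = 1 -> exists x, normc (u - g x) <= e).
Proof.
move=> e0.
have [K KP] : exists K : nat, 2 / e <= K%:R.
  exists (Num.bound (2 / e)); apply: ltW; apply: archi_boundP.
  by rewrite divr_ge0 // ltW.
have KR : 0 < K%:R :> R by apply: lt_le_trans KP; rewrite divr_gt0.
have K0 : (0 < K)%N by rewrite -(ltr0n R).
pose G : finType := ((bool * 'I_K.+1) * (bool * 'I_K.+1))%type.
pose h (p : bool * 'I_K.+1) : R := sgnb R p.1 * (p.2%:R / K%:R).
pose v (x : G) : R[i] := (h x.1 +i* h x.2)%C.
(* Grid points outside the disk are sent to 0; the points that approximate the circle lie inside and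
   are kept. *)
exists G, (fun x => if normc (v x) <= 1 then v x else 0); split.
  by move=> x; case: ifP => // _; rewrite Normc.normc0.
move=> u u1; have R1 := Re_le_normc u; have I1 := Im_le_normc u; rewrite u1 in R1 I1.
have [b1 [a1 [E1 F1]]] := grid_approx K0 R1.
have [b2 [a2 [E2 F2]]] := grid_approx K0 I1.
exists ((b1, a1), (b2, a2)); case: ifP => [_|/negP[]]; last first.
  rewrite /v /h -[X in _ <= X]u1 /=; case: (u) F1 F2 => x y /= F1 F2.
  have sq (p q : R) : `|p| <= `|q| -> p ^+ 2 <= q ^+ 2.
    by move=> pq; rewrite -(real_normK (num_real p)) -(real_normK (num_real q)) lerXn2r ?nnegrE.
  by apply: ler_wsqrtr; apply: lerD; apply: sq.
apply: le_trans (normc_le_ReIm _) _.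
rewrite /v /h; case: (u) E1 E2 => x y /= E1 E2; apply: le_trans (lerD E1 E2) _.
have -> : K%:R^-1 + K%:R^-1 = 2 / K%:R :> R by ring.
by rewrite ler_pdivrMr // mulrC -ler_pdivrMr.
Qed.

Variable n : nat.

Definition upd (z : 'I_n -> R[i]) (i : 'I_n) (t : R[i]) : 'I_n -> R[i] :=
  fun j => if j == i then t else z j.

Definition multi_affine (F : ('I_n -> R[i]) -> R[i]) :=
  forall i z, exists a b, forall t, F (upd z i t) = a + b * t.

(** On the unit circle |a + b u| reaches |a| + |b|, at u = q / p. A net point near u loses at most
    |b| e, exactly what the restriction to |t| <= 1 - e takes away, so the comparison has constant
    1. *)
Lemma affine_net_max (G : finType) (g : G -> R[i]) (e : R) (a b t : R[i]) :
  (forall u, normc u = 1 -> exists x, normc (u - g x) <= e) -> normc t <= 1 - e ->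
  exists x, normc (a + b * t) <= normc (a + b * g x).
Proof.
move=> net te; have [p p1 pa] := exists_phase a; have [q q1 qb] := exists_phase b.
have p0 : p != 0 by apply/eqP => p0; move: p1; rewrite p0 Normc.normc0 => /eqP; rewrite eq_sym oner_eq0.
have u1 : normc (q / p) = 1 by rewrite Normc.normcM Normc.normcV p1 q1 invr1 mulr1.
have [x xu] := net _ u1; exists x.
have E : normc (a + b * (q / p)) = normc a + normc b.
  have -> : a + b * (q / p) = (normc a + normc b)%:C%C / p.
    have -> : (normc a + normc b)%:C%C = p * a + q * b by rewrite pa qb; exact: rmorphD.
    by field.
  rewrite Normc.normcM Normc.normcV p1 invr1 mulr1 normc_real ger0_norm //.
  by rewrite addr_ge0 ?normc_ge0.
have h1 : normc (a + b * t) <= normc a + normc b * (1 - e).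
  apply: le_trans (normcD_le _ _) _; rewrite lerD2l Normc.normcM.
  by rewrite ler_wpM2l ?normc_ge0.
have h2 : normc a + normc b <= normc (a + b * g x) + normc b * e.
  rewrite -E; have -> : a + b * (q / p) = (a + b * g x) + b * (q / p - g x) by ring.
  apply: le_trans (normcD_le _ _) _; rewrite lerD2l Normc.normcM.
  by rewrite ler_wpM2l ?normc_ge0.
by apply: le_trans h1 _; rewrite mulrBr mulr1 addrA lerBlDr.
Qed.

(** Coordinates are moved to the net one at a time without decreasing the modulus. In [H] those
    below j are still free and those from j on already lie in the net. *)
Lemma multi_affine_max (G : finType) (g : G -> R[i]) (e B : R) F :
  (forall u, normc u = 1 -> exists x, normc (u - g x) <= e) -> multi_affine F ->
  (forall x : {ffun 'I_n -> G}, normc (F (fun i => g (x i))) <= B) ->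
  forall z, (forall i, normc (z i) <= 1 - e) -> normc (F z) <= B.
Proof.
move=> net aF FB z ze.
suff H (j : nat) : (j <= n)%N -> forall y : 'I_n -> R[i],
    (forall i : 'I_n, (i < j)%N -> normc (y i) <= 1 - e) ->
    (forall i : 'I_n, (j <= i)%N -> exists x, y i = g x) -> normc (F y) <= B.
  by apply: (H n) => // i; rewrite leqNgt ltn_ord.
elim: j => [_ y _ yg|j IH jn y y1 yg].
  have {}yg i : {x | y i = g x} by apply: cid; exact: yg.
  have -> : y = (fun i => g ([ffun i => sval (yg i)] i)).
    by apply/funext => i; rewrite ffunE; case: (yg i).
  exact: FB.
pose i0 := Ordinal jn.
have [a [b ab]] := aF i0 y.
have yE : upd y i0 (y i0) = y by apply/funext => i; rewrite /upd; case: eqP => [->|].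
have [x xB] := affine_net_max a b net (y1 i0 (ltnSn j)).
move: xB; rewrite -!ab yE => /le_trans; apply; apply: IH; first exact: ltnW.
  by move=> i ij; rewrite /upd ifN; [apply: y1; exact: ltnW|rewrite -val_eqE /= ltn_eqF].
move=> i; rewrite /upd; case: eqP => [_ _|/eqP ii0 ij]; first by exists x.
by apply: yg; rewrite ltn_neqAle ij andbT; apply: contra ii0 => /eqP E; apply/eqP/val_inj.
Qed.

(** This is r^|S|. Sets of variables are Boolean functions, so that a sum over all sets of such
    products is a product of sums. *)
Definition set_weight (r : R) (S : {ffun 'I_n -> bool}) : R := \prod_(i < n) (if S i then r else 1).

Definition set_monom (z : 'I_n -> R[i]) (S : {ffun 'I_n -> bool}) : R[i] :=
  \prod_(i < n) (if S i then z i else 1).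

(** Leaving out the empty set makes the constant term 0. *)
Definition sign_poly (e : {ffun {ffun 'I_n -> bool} -> bool}) (r : R) (z : 'I_n -> R[i]) : R[i] :=
  \sum_(S | S != [ffun=> false]) (sgnb R (e S) * set_weight r S)%:C%C * set_monom z S.

Lemma sum_set_weight (r : R) : \sum_S set_weight r S = (1 + r) ^+ n.
Proof.
rewrite -(bigA_distr_bigA (fun (i : 'I_n) (b : bool) => if b then r else 1)) /=.
by rewrite big_bool /= prodr_const card_ord addrC.
Qed.

Lemma set_weight_sqr (r : R) S : set_weight r S ^+ 2 = set_weight (r ^+ 2) S.
Proof. by rewrite -prodrXl; apply: eq_bigr => i _; case: ifP; rewrite ?expr1n. Qed.

Lemma normc_set_monom z S : normc (set_monom z S) = \prod_(i < n) (if S i then normc (z i) else 1).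
Proof. by rewrite normc_prod; apply: eq_bigr => i _; case: ifP; rewrite ?Normc.normc1. Qed.

Lemma normc_set_monom_le1 z S : (forall i, normc (z i) <= 1) -> normc (set_monom z S) <= 1.
Proof.
move=> z1; rewrite normc_set_monom.
rewrite -[X in _ <= X](_ : \prod_(i < n) (1 : R) = 1); last by rewrite big1_eq.
by apply: ler_prod => i _; case: ifP; rewrite ?ler01 ?lexx ?normc_ge0 //= z1.
Qed.

Lemma sign_poly_affine e r : multi_affine (sign_poly e r).
Proof.
move=> i z.
pose c S := (sgnb R (e S) * set_weight r S)%:C%C.
pose rest (S : {ffun 'I_n -> bool}) := \prod_(j < n | j != i) (if S j then z j else 1).
exists (\sum_(S | S != [ffun=> false]) (if S i then 0 else c S * rest S)).
exists (\sum_(S | S != [ffun=> false]) (if S i then c S * rest S else 0)) => t.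
rewrite big_distrl -big_split; apply: eq_bigr => S _ /=.
have -> : set_monom (upd z i t) S = (if S i then t else 1) * rest S.
  rewrite /set_monom (bigD1 i) //= /upd eqxx; congr (_ * _).
  by apply: eq_bigr => j ji; rewrite (negbTE ji).
rewrite -/(c S); case: (S i); first by rewrite add0r mulrCA mulrC.
by rewrite mul0r addr0 mul1r.
Qed.

End RandomPolynomial.

Lemma random_sign_poly (R : realType) (e : R) : 0 < e ->
  exists2 C : R, 0 < C & forall n : nat, (0 < n)%N -> forall r : R, 0 <= r ->
  exists s : {ffun {ffun 'I_n -> bool} -> bool},
    forall z, (forall i, normc (z i) <= 1 - e) ->
      normc (sign_poly s r z) <= C * Num.sqrt (n%:R * (1 + r ^+ 2) ^+ n).
Proof.
move=> e0; have [G [g [g1 net]]] := unit_circle_net e0.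
have G0 : (0 < #|G|)%N.
  by have [x _] := net 1 (Normc.normc1 R); apply/card_gt0P; exists x.
(* The index set J below counts net points and the choice of real or imaginary part, so 2|J| = 4
   |G|^n <= e^(n l) for n >= 1. The two parts, each with constant 3, give the 6. *)
pose l : R := ln (4 * #|G|%:R).
have l0 : 0 < l.
  by apply: ln_gt0; apply: (@lt_le_trans _ _ 4); [rewrite ltr1n|rewrite ler_peMr ?ler1n].
exists (6 * Num.sqrt l); first by rewrite mulr_gt0 // sqrtr_gt0.
move=> n n0 r r0; set V := (1 + r ^+ 2) ^+ n.
have V0 : 0 < V by rewrite exprn_gt0 // ltr_pwDl ?sqr_ge0.
have nR : 0 < n%:R :> R by rewrite ltr0n.
pose J : finType := ({ffun 'I_n -> G} * bool)%type.
pose zx (x : {ffun 'I_n -> G}) : 'I_n -> R[i] := fun i => g (x i).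
pose part (b : bool) (u : R[i]) : R := if b then complex.Re u else complex.Im u.
pose t (j : J) (S : {ffun 'I_n -> bool}) : R :=
  if S != [ffun=> false] then set_weight r S * part j.2 (set_monom (zx j.1) S) else 0.
have tV j : \sum_S t j S ^+ 2 <= V.
  rewrite /V -sum_set_weight; apply: ler_sum => S _; rewrite -set_weight_sqr /t.
  case: ifP => _; last by rewrite expr0n sqr_ge0.
  rewrite exprMn ler_piMr ?sqr_ge0 // -(real_normK (num_real _)) expr_le1 //.
  apply: (@le_trans _ _ (normc (set_monom (zx j.1) S))).
    by rewrite /part; case: (j.2); [exact: Re_le_normc|exact: Im_le_normc].
  by apply: normc_set_monom_le1 => i; exact: g1.
have A0 : 0 < n%:R * l by rewrite mulr_gt0.
have JA : 2 * #|J|%:R <= expR (n%:R * l).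
  rewrite expRM_natl lnK ?posrE ?mulr_gt0 ?ltr0n // card_prod card_bool card_ffun card_ord.
  have -> : 2 * (#|G| ^ n * 2)%:R = 4 * #|G|%:R ^+ n :> R by rewrite natrM natrX; ring.
  rewrite exprMn; by rewrite ler_wpM2r ?exprn_ge0 // ler_eXnr // ler1n.
have [s sP] := rademacher_max V0 A0 tV JA.
exists s; apply: (multi_affine_max net (sign_poly_affine s r)) => x.
apply: le_trans (normc_le_ReIm _) _.
have partE b : part b (sign_poly s r (zx x)) = \sum_S sgnb R (s S) * t (x, b) S.
  have part0 : part b 0 = 0 by rewrite /part; case: (b).
  have partD u v : part b (u + v) = part b u + part b v by rewrite /part; case: (b); case: u; case: v.
  rewrite /sign_poly (big_morph _ partD part0) big_mkcond; apply: eq_bigr => S _.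
  rewrite /t; case: ifP => _; last by rewrite mulr0.
  by rewrite mulrA /part; case: (b); case: (set_monom _ _) => u v /=; ring.
have -> : 6 * Num.sqrt l * Num.sqrt (n%:R * V) = 3 * Num.sqrt (n%:R * l * V) + 3 * Num.sqrt (n%:R * l * V).
  have -> : Num.sqrt (n%:R * l * V) = Num.sqrt l * Num.sqrt (n%:R * V).
    by rewrite -sqrtrM ?(ltW l0) //; congr Num.sqrt; ring.
  by ring.
by apply: lerD; [have := sP (x, true)|have := sP (x, false)]; rewrite -partE.
Qed.

(** * Norms on a finite-dimensional space *)

Section FiniteDimensionalNorm.
Variables (R : realType) (d : nat) (N : 'rV[R[i]]_d -> R).
Hypothesis hN : is_cnorm N.

Lemma cnormD x y : N (x + y) <= N x + N y.
Proof. by case: hN. Qed.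

Lemma cnormZ (a : R[i]) x : N (a *: x) = normc a * N x.
Proof. by case: hN. Qed.

Lemma cnorm0 : N 0 = 0.
Proof. by rewrite -(scale0r 0) cnormZ Normc.normc0 mul0r. Qed.

Lemma cnormN x : N (- x) = N x.
Proof. by rewrite -scaleN1r cnormZ normc_opp Normc.normc1 mul1r. Qed.

Lemma cnorm_ge0 x : 0 <= N x.
Proof.
have := cnormD x (- x); rewrite subrr cnorm0 cnormN -mulr2n.
by rewrite -mulr_natr pmulr_lge0.
Qed.

Lemma cnorm_sum (I : Type) (s : seq I) (P : pred I) (F : I -> 'rV[R[i]]_d) :
  N (\sum_(i <- s | P i) F i) <= \sum_(i <- s | P i) N (F i).
Proof.
elim: s => [|i s IH]; first by rewrite !big_nil cnorm0.
rewrite !big_cons; case: ifP => // _.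
by apply: le_trans (cnormD _ _) _; rewrite lerD2l.
Qed.

Lemma cnorm_distr x y : `|N x - N y| <= N (x - y).
Proof.
have H a b : N a - N b <= N (a - b).
  by rewrite lerBlDr; apply: le_trans _ (cnormD _ _); rewrite subrK.
by rewrite ler_norml H andbT lerNl opprB -(cnormN (x - y)) opprB.
Qed.

Lemma cnorm_le_coord : exists2 C, 0 < C &
  forall x, N x <= C * \sum_(j < d) normc (x 0 j).
Proof.
pose C := 1 + \sum_(j < d) N (delta_mx 0 j).
have S0 : 0 <= \sum_(j < d) N (delta_mx 0 j) by apply: sumr_ge0 => j _; exact: cnorm_ge0.
exists C => [|x]; first by rewrite ltr_pwDl.
rewrite {1}(row_sum_delta x); apply: le_trans (cnorm_sum _ _ _) _.
rewrite big_distrr; apply: ler_sum => j _ /=.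
rewrite cnormZ mulrC ler_wpM2r ?normc_ge0 // /C (bigD1 j) //= addrCA lerDl.
by rewrite addr_ge0 // sumr_ge0 // => i _; exact: cnorm_ge0.
Qed.

(** Equivalence of norms by compactness: [h] identifies real row vectors of length d + d with the
    space, N composed with h is Lipschitz, and its minimum on the unit sphere is positive as N
    vanishes only at 0. *)
Lemma cnorm_ge_coord : (0 < d)%N -> exists2 C, 0 < C &
  forall (x : 'rV[R[i]]_d) j, normc (x 0 j) <= C * N x.
Proof.
move=> d0; have [C1 C10 C1P] := cnorm_le_coord.
pose h (v : 'rV[R]_(d + d)) : 'rV[R[i]]_d :=
  \row_j (lsubmx v 0 j +i* rsubmx v 0 j)%C.
pose f v := N (h v).
have hB v w : h v - h w = h (v - w).
  by apply/rowP => j; rewrite !mxE.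
have hle v j : normc (h v 0 j) <= 2 * `|v|.
  have coord i : `|v 0 i| <= `|v|.
    by rewrite [leRHS]/Num.norm /= mx_normrE; apply/bigmax_geP; right; exists (0, i).
  rewrite !mxE /=; apply: (@le_trans _ _ (`|v 0 (lshift d j)| + `|v 0 (rshift d j)|)).
    set a := v _ _; set b := v _ _.
    rewrite -[leRHS]ger0_norm ?addr_ge0 // -sqrtr_sqr.
    apply: ler_wsqrtr; rewrite sqrrD !real_normK ?num_real //.
    by rewrite addrAC lerDl mulrn_wge0 // mulr_ge0.
  by rewrite mulr_natl mulr2n lerD.
pose K := C1 * (d%:R * 2) + 1.
have K0 : 0 < K by rewrite ltr_wpDl // !mulr_ge0 // ltW.
have fle v w : `|f v - f w| <= K * `|v - w|.
  apply: le_trans (cnorm_distr _ _) _; rewrite hB; apply: le_trans (C1P _) _.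
  apply: (@le_trans _ _ (C1 * (d%:R * 2) * `|v - w|)); last by rewrite ler_wpM2r // lerDl.
  rewrite -!mulrA; apply: ler_wpM2l; first exact: ltW.
  apply: (@le_trans _ _ (\sum_(j < d) 2 * `|v - w|)); first by apply: ler_sum.
  by rewrite sumr_const card_ord -[leLHS]mulr_natl.
have fc : continuous f.
  move=> v; apply/(@cvgrPdist_le R R 'rV[R]_(d + d) (nbhs v) (nbhs_filter v)) => e e0.
  apply/nbhs_ballP.
  exists (e / K); first by rewrite /= divr_gt0.
  rewrite -ball_normE => w /= vw; apply: le_trans (fle _ _) _.
  by rewrite mulrC -ler_pdivlMr // ltW.
pose A := ((fun v : 'rV[R]_(d + d) => `|v|) @^-1` [set x | 1 <= x]) `&`
          ((fun v : 'rV[R]_(d + d) => `|v|) @^-1` [set x | x <= 1]).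
have Acl : closed A.
  by apply: closedI; apply: preimage_closed => [v _|];
    [exact: norm_continuous|exact: closed_ge|exact: norm_continuous|exact: closed_le].
have Acp : compact A.
  apply: bounded_closed_compact => //; exists 1; split => // x x1 v [_ /= v1].
  exact: le_trans v1 (ltW x1).
have norm_scale (v : 'rV[R]_(d + d)) : v != 0 -> A (`|v|^-1 *: v).
  move=> v0; have E : `| `|v|^-1 *: v| = 1.
    by rewrite normrZ normfV normr_id mulVf // normr_eq0.
  by split; rewrite /= E.
have [v0 v0n] : exists v : 'rV[R]_(d + d), v != 0.
  exists (const_mx 1); apply/negP => /eqP /rowP /(_ (lshift d (Ordinal d0))).
  by rewrite !mxE => /eqP; rewrite oner_eq0.
have A0 : A !=set0 by exists (`|v0|^-1 *: v0); exact: norm_scale.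
have [w wA wmin] := EVT_min_rV A0 Acp (continuous_subspaceT fc).
have w1 : `|w| = 1.
  by move: wA; rewrite inE => -[/= w1 w2]; apply/eqP; rewrite eq_le w1 w2.
have fw : 0 < f w.
  rewrite lt_def cnorm_ge0 andbT; apply/eqP => /(let: And3 h0 _ _ := hN in h0 _) hw0.
  have : w = 0.
    apply/rowP => i; rewrite mxE; case: (splitP i) => j ij.
      have := congr1 (fun x : 'rV[R[i]]_d => complex.Re (x 0 j)) hw0.
      by rewrite !mxE /=; congr (w _ _ = _); apply: val_inj.
    have := congr1 (fun x : 'rV[R[i]]_d => complex.Im (x 0 j)) hw0.
    by rewrite !mxE /=; congr (w _ _ = _); apply: val_inj.
  by move=> w0; move: w1; rewrite w0 normr0 => /eqP; rewrite eq_sym oner_eq0.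
exists (2 / f w); first by rewrite divr_gt0.
move=> x j; pose v : 'rV[R]_(d + d) :=
  row_mx (\row_k complex.Re (x 0 k)) (\row_k complex.Im (x 0 k)).
have hv : h v = x.
  by apply/rowP => k; rewrite mxE row_mxKl row_mxKr !mxE; case: (x 0 k).
have [v00|vn] := eqVneq v 0.
  have -> : x = 0 by rewrite -hv v00; apply/rowP => k; rewrite !mxE.
  by rewrite mxE Normc.normc0 cnorm0 mulr0.
have vp : 0 < `|v| by rewrite normr_gt0.
have := wmin (`|v|^-1 *: v); rewrite inE => /(_ (norm_scale v vn)).
have -> : f (`|v|^-1 *: v) = `|v|^-1 * f v.
  rewrite /f; have -> : h (`|v|^-1 *: v) = (`|v|^-1)%:C%C *: h v.
    apply/rowP => k; rewrite !mxE; apply/eqP; rewrite eq_complex /=.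
    by rewrite !mul0r subr0 addr0 !eqxx.
  by rewrite cnormZ normc_real ger0_norm // invr_ge0.
rewrite mulrC ler_pdivlMr // {2}/f hv => fv.
rewrite -hv; apply: le_trans (hle v j) _; rewrite hv mulrAC ler_pdivlMr //.
by rewrite -mulrA ler_wpM2l // mulrC.
Qed.

End FiniteDimensionalNorm.

(** * Homogeneous parts of a power series *)

Section NonnegativeSums.
Variable R : realType.

Lemma ler_sum_uniq_sub (T : eqType) (s t : seq T) (F : T -> R) :
  uniq s -> uniq t -> {subset s <= t} -> (forall x, 0 <= F x) ->
  \sum_(x <- s) F x <= \sum_(x <- t) F x.
Proof.
move=> us ut st F0; rewrite [leRHS](bigID (mem s)) /= -[X in _ <= X + _]big_filter.
rewrite (perm_big [seq x <- t | x \in s]); first by rewrite lerDl sumr_ge0.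
apply: uniq_perm => //; first by rewrite filter_uniq.
move=> x; rewrite mem_filter; have [xs|//] := boolP (x \in s).
by rewrite (st x xs).
Qed.

Lemma esum_le_seq (T : choiceType) (D : set T) (F : T -> R) (B : R) :
  (forall s, uniq s -> (forall x, x \in s -> D x) -> \sum_(x <- s) F x <= B) ->
  (\esum_(x in D) (F x)%:E <= B%:E)%E.
Proof.
move=> FB; apply: ge_ereal_sup => _ [X [finX XD] <-].
rewrite fsbig_finite //= sumEFin lee_fin; apply: FB.
  exact: finmap.fset_uniq.
by move=> x; rewrite in_fset_set // inE => /XD.
Qed.

Lemma esum_ge_seq (T : choiceType) (D : set T) (F : T -> R) (s : seq T) :
  uniq s -> (forall x, x \in s -> D x) ->
  ((\sum_(x <- s) F x)%:E <= \esum_(x in D) (F x)%:E)%E.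
Proof.
move=> us sD; apply: esum_ge; exists [set` s].
  by split; [exact: finite_seq|move=> x /= /sD].
by rewrite -fsbig_seq // sumEFin lexx.
Qed.

End NonnegativeSums.

Section Slices.
Variable n : nat.

Definition box (K : nat) : seq (n.-tuple nat) :=
  [seq tuple_of_ffun b | b <- index_enum {ffun 'I_n -> 'I_K.+1}].

Lemma mdeg_tuple_of_ffun (K : nat) (b : {ffun 'I_n -> 'I_K.+1}) :
  mdeg (tuple_of_ffun b) = (\sum_(i < n) (b i : nat))%N.
Proof. by apply: eq_bigr => i _; rewrite tnth_mktuple. Qed.

Lemma box_uniq K : uniq (box K).
Proof.
rewrite map_inj_uniq ?index_enum_uniq // => b1 b2 /(congr1 (fun t => tnth t)) E.
by apply/ffunP => i; apply: val_inj; have := congr1 (@^~ i) E; rewrite !tnth_mktuple.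
Qed.

Lemma tnth_le_mdeg (a : n.-tuple nat) i : (tnth a i <= mdeg a)%N.
Proof. by rewrite /mdeg (bigD1 i) //= leq_addr. Qed.

Lemma mem_box K a : (a \in box K) = [forall i, (tnth a i <= K)%N].
Proof.
apply/mapP/forallP => [[b _ ->] i|aK]; first by rewrite tnth_mktuple -ltnS.
exists [ffun i => inord (tnth a i)]; first exact: mem_index_enum.
by apply: eq_from_tnth => i; rewrite tnth_mktuple ffunE inordK // ltnS.
Qed.

Lemma mdeg_mem_box K a : (mdeg a <= K)%N -> a \in box K.
Proof. by move=> aK; rewrite mem_box; apply/forallP => i; exact: leq_trans (tnth_le_mdeg a i) aK. Qed.

(** [box m] is large enough: no entry of an exponent exceeds its degree. *)
Definition slice (m : nat) : seq (n.-tuple nat) := [seq a <- box m | mdeg a == m].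

Lemma mem_slice m a : (a \in slice m) = (mdeg a == m).
Proof. by rewrite mem_filter andb_idr // => /eqP am; rewrite mdeg_mem_box // am. Qed.

Lemma slice_uniq m : uniq (slice m).
Proof. by rewrite filter_uniq // box_uniq. Qed.

Lemma sum_box_slices (V : nmodType) (F : n.-tuple nat -> V) (K : nat) :
  \sum_(a <- box K | (mdeg a <= K)%N) F a = \sum_(m < K.+1) \sum_(a <- slice m) F a.
Proof.
transitivity (\sum_(m < K.+1) \sum_(a <- box K | mdeg a == m) F a).
  rewrite (exchange_big_dep (fun a => (mdeg a <= K)%N)) /=; last first.
    by move=> m a _ /eqP ->; rewrite -ltnS.
  apply: eq_bigr => a aK.
  rewrite (big_pred1 (Ordinal (aK : (mdeg a < K.+1)%N))) //.
apply: eq_bigr => m _; rewrite -big_filter; apply: perm_big.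
apply: uniq_perm; rewrite ?filter_uniq ?box_uniq ?slice_uniq // => a.
rewrite mem_slice mem_filter andb_idr // => /eqP am.
by rewrite mdeg_mem_box // am -ltnS.
Qed.

Lemma mdeg_eq0 (a : n.-tuple nat) : (mdeg a == 0)%N = (a == Defs.mzero n).
Proof.
apply/eqP/eqP => [a0|->]; last by rewrite /mdeg big1 // => i _; rewrite tnth_mktuple.
apply: eq_from_tnth => i; rewrite tnth_mktuple; apply/eqP.
by rewrite -leqn0 -a0 tnth_le_mdeg.
Qed.

Lemma slice0 : slice 0 = [:: Defs.mzero n].
Proof.
apply: perm_small_eq => //; apply: uniq_perm => //; first exact: slice_uniq.
by move=> a; rewrite mem_slice mdeg_eq0 inE.
Qed.

Lemma sum_slices_ge (R : realType) (F : n.-tuple nat -> R) (s : seq (n.-tuple nat)) :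
  uniq s -> (forall a, a \in s -> (0 < mdeg a)%N) -> (forall a, 0 <= F a) ->
  exists T, \sum_(a <- s) F a <= \sum_(m < T | (0 < m)%N) \sum_(a <- slice m) F a.
Proof.
move=> us s0 F0; pose K := \max_(a <- s) mdeg a; exists K.+1.
have -> : \sum_(m < K.+1 | (0 < m)%N) \sum_(a <- slice m) F a =
          \sum_(a <- [seq a <- box K | (mdeg a <= K)%N] | (0 < mdeg a)%N) F a.
  rewrite [RHS]big_mkcond big_filter sum_box_slices big_mkcond /=.
  apply: eq_bigr => m _; case: ifP => m0.
    by rewrite !big_seq; apply: eq_bigr => a; rewrite mem_slice => /eqP ->; rewrite m0.
  by rewrite big_seq big1 // => a; rewrite mem_slice => /eqP ->; rewrite m0.
rewrite -[leRHS]big_filter; apply: ler_sum_uniq_sub => //.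
  by rewrite !filter_uniq // box_uniq.
move=> a sa; rewrite !mem_filter s0 //=.
have aK : (mdeg a <= K)%N by rewrite leq_bigmax_seq.
by rewrite aK mdeg_mem_box.
Qed.

End Slices.

Section HomogeneousParts.
Variables (R : realType) (d : nat).

Definition hom_part n (c : n.-tuple nat -> 'rV[R[i]]_d) (z : 'I_n -> R[i]) (m : nat) :=
  \sum_(a <- slice n m) cmonom a z *: c a.

Lemma psum_hom_part n (c : n.-tuple nat -> 'rV[R[i]]_d) z K :
  psum c z K = \sum_(m < K.+1) hom_part c z m.
Proof.
rewrite /hom_part -sum_box_slices big_map.
by apply: eq_bigl => b; rewrite mdeg_tuple_of_ffun.
Qed.

Lemma cmonom_scale n (a : n.-tuple nat) (t : R[i]) z :
  cmonom a (fun i => t * z i) = t ^+ mdeg a * cmonom a z.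
Proof.
by rewrite /cmonom /mdeg expr_sum -big_split; apply: eq_bigr => i _; rewrite exprMn.
Qed.

Lemma hom_part_scale n (c : n.-tuple nat -> 'rV[R[i]]_d) (t : R[i]) z m :
  hom_part c (fun i => t * z i) m = t ^+ m *: hom_part c z m.
Proof.
rewrite /hom_part scaler_sumr !big_seq; apply: eq_bigr => a; rewrite mem_slice => /eqP am.
by rewrite cmonom_scale am scalerA.
Qed.

Lemma hom_part0 n (c : n.-tuple nat -> 'rV[R[i]]_d) z : hom_part c z 0 = c (Defs.mzero n).
Proof.
rewrite /hom_part slice0 big_seq1 /cmonom big1 ?scale1r // => i _.
by rewrite tnth_mktuple.
Qed.

Lemma hom_part_uni (g : 1.-tuple nat -> 'rV[R[i]]_d) t m :
  hom_part g t m = t ord0 ^+ m *: g [tuple m].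
Proof.
have -> : hom_part g t m = \sum_(a <- [:: [tuple m]]) cmonom a t *: g a.
  apply: perm_big; apply: uniq_perm => //; first exact: slice_uniq.
  move=> a; rewrite mem_slice inE /mdeg big_ord1; apply/eqP/eqP => [am|->//].
  by apply: eq_from_tnth => i; rewrite (ord1 i) am.
by rewrite big_seq1 /cmonom big_ord1.
Qed.

Lemma normc_cmonom n (a : n.-tuple nat) (r : R) (z : 'I_n -> R[i]) :
  (forall i, normc (z i) <= r) -> normc (cmonom a z) <= r ^+ mdeg a.
Proof.
move=> zr; rewrite /cmonom normc_prod /mdeg expr_sum; apply: ler_prod => i _.
rewrite normcX exprn_ge0 ?normc_ge0 //= lerXn2r ?nnegrE ?normc_ge0 //.
by apply: le_trans (zr i); exact: normc_ge0.
Qed.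

Definition coord_mpoly n (c : n.-tuple nat -> 'rV[R[i]]_d) (u : 'I_d) (m : nat) :
    mpoly.mpoly n R[i] :=
  \sum_(a <- slice n m) c a 0 u *: mpoly.mpolyX _ (mpoly.Multinom a).

Lemma meval_coord_mpoly n (c : n.-tuple nat -> 'rV[R[i]]_d) u m z :
  mpoly.meval z (coord_mpoly c u m) = hom_part c z m 0 u.
Proof.
rewrite /coord_mpoly raddf_sum /hom_part summxE; apply: eq_bigr => a _.
by rewrite /= mpoly.mevalZ mpoly.mevalX mxE mulrC.
Qed.

Lemma mcoeff_coord_mpoly n (c : n.-tuple nat -> 'rV[R[i]]_d) u m b :
  mpoly.mcoeff b (coord_mpoly c u m) =
  if mdeg (mpoly.multinom_val b) == m then c (mpoly.multinom_val b) 0 u else 0.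
Proof.
rewrite /coord_mpoly raddf_sum /=.
under eq_bigr => a _ do rewrite mpoly.mcoeffZ mpoly.mcoeffX.
have E (a : n.-tuple nat) : (mpoly.Multinom a == b) = (a == mpoly.multinom_val b) by [].
case: ifP => bm.
  rewrite (bigD1_seq (mpoly.multinom_val b)) ?slice_uniq ?mem_slice //= E eqxx mulr1.
  by rewrite big1 ?addr0 // => a ab; rewrite E (negbTE ab) mulr0.
rewrite big1_seq // => a /andP[_]; rewrite mem_slice => am; rewrite E.
by case: eqP => [ab|_]; [rewrite ab bm in am|rewrite mulr0].
Qed.

Lemma homogeneous_coord_mpoly n (c : n.-tuple nat -> 'rV[R[i]]_d) u m :
  homogeneous m (coord_mpoly c u m).
Proof.
move=> b; rewrite mpoly.mcoeff_msupp mcoeff_coord_mpoly; case: ifP => [/eqP bm _|]; last by rewrite eqxx.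
by rewrite -bm mpoly.mdegE; apply: eq_bigr.
Qed.

Lemma coef_l1_coord_mpoly n (c : n.-tuple nat -> 'rV[R[i]]_d) u m :
  \sum_(a <- slice n m) normc (c a 0 u) <= coef_l1 (coord_mpoly c u m).
Proof.
have us : uniq [seq mpoly.Multinom a | a <- slice n m].
  by rewrite map_inj_uniq ?slice_uniq // => a b [].
apply: le_trans _ (coef_l1_seq _ us); rewrite big_map !big_seq.
by apply: ler_sum => a; rewrite mem_slice mcoeff_coord_mpoly /= => ->.
Qed.

End HomogeneousParts.

(** * Homogeneous parts as one-variable Taylor coefficients *)

Section LowerBound.
Variables (R : realType) (d : nat) (N : 'rV[R[i]]_d -> R).
Hypothesis hN : is_cnorm N.

Lemma cvg0_nat (u : nat -> R) : (forall n, 0 <= u n) ->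
  (u @ \oo --> (0 : R)) <-> (forall e, 0 < e -> exists N0, forall n, (N0 <= n)%N -> u n <= e).
Proof.
move=> u0; split => [/cvgrPdist_le H e e0|H].
  have [N0 _ N0P] := H e e0; exists N0 => n Nn.
  by have := N0P n Nn; rewrite /= sub0r normrN ger0_norm.
apply/cvgrPdist_le => e e0; have [N0 N0P] := H e e0.
exists N0 => // n Nn /=; rewrite sub0r normrN ger0_norm //; exact: N0P.
Qed.

Lemma hom_part_norm_sum n (c : n.-tuple nat -> 'rV[R[i]]_d) z T :
  \sum_(m < T) N (hom_part c z m) <= \sum_(m < T) \sum_(a <- slice n m) N (cmonom a z *: c a).
Proof. by apply: ler_sum => m _; exact: cnorm_sum. Qed.

Lemma sum_roots_dvd (m k : nat) (w : R[i]) : (0 < m)%N -> m.-primitive_root w ->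
  \sum_(j < m) (w ^+ j) ^+ k = if (m %| k)%N then m%:R else 0.
Proof.
move=> m0 wm.
have := sum_roots_orthogonal m0 wm (ltn_pmod k m0) m0.
under eq_bigr => j _.
  rewrite expr0 conjc1 mulr1 -exprM mulnC exprM (prim_expr_mod wm) -exprM mulnC exprM.
  over.
by rewrite /dvdn => ->; case: eqP => _; rewrite ?muln1 ?muln0.
Qed.

(* Averaging z |-> f(w^j t z) over the m-th roots of unity w^j keeps the bound
   and turns the m-th homogeneous part into a first Taylor coefficient. *)
Lemma hom_part_bounded_holo n (c : n.-tuple nat -> 'rV[R[i]]_d) (z : 'I_n -> R[i]) (m : nat) :
  (0 < m)%N -> bounded_holo N c -> in_polydisk 1 z ->
  bounded_holo N (fun a : 1.-tuple nat => hom_part c z (m * tnth a ord0)).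
Proof.
move=> m0 [cs cv] z1; split => [t t1|t t1].
  pose F a := N (cmonom a z *: c a).
  have F0 a : 0 <= F a by exact: (cnorm_ge0 hN).
  have fin : (\esum_(a in [set: n.-tuple nat]) (F a)%:E \is a fin_num)%E.
    by rewrite ge0_fin_numE ?cs // esum_ge0 // => a _; rewrite lee_fin.
  apply: (@le_lt_trans _ _ (fine (\esum_(a in [set: n.-tuple nat]) (F a)%:E)%E)%:E); last exact: ltry.
  apply: esum_le_seq => s us _.
  pose K := \max_(a <- s) (m * tnth a ord0)%N.
  apply: (@le_trans _ _ (\sum_(k <- map (fun a : 1.-tuple nat => (m * tnth a ord0)%N) s) N (hom_part c z k))).
    rewrite big_map; apply: ler_sum => a _; rewrite (cnormZ hN) ler_piMl ?(cnorm_ge0 hN) //.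
    apply: le_trans (normc_cmonom _ (r := 1) _) _; last by rewrite expr1n.
    by move=> i; exact: ltW.
  apply: (@le_trans _ _ (\sum_(k <- iota 0 K.+1) N (hom_part c z k))).
    apply: ler_sum_uniq_sub; rewrite ?iota_uniq //; last by move=> k; exact: (cnorm_ge0 hN).
      rewrite map_inj_in_uniq // => a b _ _ /eqP; rewrite eqn_pmul2l // => /eqP ab.
      by apply: eq_from_tnth => i; rewrite (ord1 i).
    move=> k /mapP[a sa ->]; rewrite mem_iota add0n ltnS /=.
    by rewrite (@leq_bigmax_seq _ s xpredT (fun a : 1.-tuple nat => (m * tnth a ord0)%N) a).
  rewrite -[iota 0 K.+1]/(index_iota 0 K.+1) big_mkord; apply: le_trans (hom_part_norm_sum _ _ _) _.
  rewrite -sum_box_slices -big_filter -lee_fin fineK //.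
  by apply: esum_ge_seq => //; rewrite filter_uniq // box_uniq.
(* With s^m = t the mean over j of f(w^j s z) is the sum of t^a P_(m a)(z), since the roots of unity
   annihilate the degrees not divisible by m. Partial sums correspond exactly: degree K in t is
   degree m K in z. *)
have [s sm] : exists s : R[i], s ^+ m = t ord0.
  by exists (nthroot m (t ord0)); rewrite rootCK.
have s1 : normc s < 1.
  by rewrite -(ltr_pXn2r m0) ?nnegrE ?normc_ge0 // expr1n -normcX sm.
have [w wm] := @exists_prim_root R m m0.
have wj1 j : normc (w ^+ j) = 1.
  by rewrite normcX (@normc_unity_root _ _ m) ?expr1n // prim_expr_order.
pose zj (j : 'I_m) : 'I_n -> R[i] := fun i => (w ^+ j * s) * z i.
have zj1 j : in_polydisk 1 (zj j).
  move=> i; rewrite /zj !Normc.normcM wj1 mul1r.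
  by apply: mulr_ilt1; rewrite ?normc_ge0 ?s1 ?z1.
have /choice [v vP] : forall j : 'I_m, exists v,
    (fun K => N (psum c (zj j) K - v)) @ \oo --> (0 : R) /\ N v <= 1 by move=> j; exact: cv.
have mC : (m%:R : R[i]) != 0 by rewrite pnatr_eq0 -lt0n.
have nm : normc (m%:R^-1 : R[i]) = m%:R^-1 by rewrite Normc.normcV normc_nat.
exists (m%:R^-1 *: \sum_j v j); split; last first.
  rewrite (cnormZ hN) nm ler_pdivrMl ?ltr0n // mulr1.
  apply: le_trans (cnorm_sum hN _ _ _) _.
  apply: (@le_trans _ _ (\sum_(j < m) 1)); first by apply: ler_sum => j _; case: (vP j).
  by rewrite sumr_const card_ord.
have avg K : psum (fun a : 1.-tuple nat => hom_part c z (m * tnth a ord0)) t K =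
    m%:R^-1 *: \sum_j psum c (zj j) (m * K).
  transitivity (\sum_(k < (m * K).+1) (if (m %| k)%N then s ^+ k else 0) *: hom_part c z k).
    rewrite psum_hom_part.
    under eq_bigr => k _ do rewrite hom_part_uni /= -sm -exprM.
    pose G k := s ^+ k *: hom_part c z k.
    transitivity (\sum_(k <- map (muln m) (iota 0 K.+1)) G k).
      by rewrite big_map -[iota 0 K.+1]/(index_iota 0 K.+1) big_mkord.
    transitivity (\sum_(k < (m * K).+1 | (m %| k)%N) G k); last first.
      by rewrite big_mkcond; apply: eq_bigr => k _; case: ifP => // _; rewrite scale0r.
    rewrite -(big_mkord (fun k => m %| k)%N) -big_filter; apply: perm_big.
    apply: uniq_perm; rewrite ?filter_uniq ?iota_uniq //.
      by rewrite map_inj_uniq ?iota_uniq // => x y /eqP; rewrite eqn_pmul2l // => /eqP.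
    move=> k; rewrite mem_filter mem_index_iota leq0n andTb ltnS; apply/mapP/andP.
      move=> [x]; rewrite mem_iota add0n ltnS /= => xK ->.
      by rewrite dvdn_mulr // leq_mul2l xK orbT.
    move=> [/dvdnP[x ->]]; rewrite mulnC leq_pmul2l // => xK.
    by exists x => //; rewrite mem_iota add0n ltnS.
  under [in RHS]eq_bigr => j _ do rewrite psum_hom_part.
  rewrite exchange_big scaler_sumr /=; apply: eq_bigr => k _.
  under eq_bigr => j _ do rewrite hom_part_scale exprMn -scalerA.
  rewrite -scaler_suml (sum_roots_dvd k m0 wm) !scalerA.
  by case: ifP => _; [rewrite mulKf|rewrite mul0r mulr0].
apply/cvg0_nat; first by move=> K; exact: (cnorm_ge0 hN).
move=> e e0.
have /choice [M MP] : forall j : 'I_m, exists N0, forall K, (N0 <= K)%N -> N (psum c (zj j) K - v j) <= e.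
  move=> j; have [/cvg0_nat H _] := vP j; apply: H => // K; exact: (cnorm_ge0 hN).
exists (\max_j M j) => K KM; rewrite avg -scalerBr -sumrB (cnormZ hN) nm ler_pdivrMl ?ltr0n //.
apply: le_trans (cnorm_sum hN _ _ _) _.
apply: (@le_trans _ _ (\sum_(j < m) e)); last by rewrite sumr_const card_ord mulr_natl.
apply: ler_sum => j _; apply: MP; apply: leq_trans (leq_pmull K m0).
by apply: leq_trans KM; exact: leq_bigmax.
Qed.

End LowerBound.

(** * Bounds for the Bohr radius *)

Section BohrLowerBound.
Variables (R : realType) (d : nat) (p q : R) (N : 'rV[R[i]]_d -> R).
Hypotheses (hp : 1 <= p) (hq : 1 <= q) (hN : is_cnorm N).

Lemma ler_poweR2 (r : R) (x y : \bar R) : 0 <= r -> (0 <= x)%E -> (x <= y)%E ->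
  (x `^ r <= y `^ r)%E.
Proof.
move=> r0 x0 xy; apply: gt0_ler_poweR => //; rewrite in_itv /= ?x0 ?leey //.
by rewrite (le_trans x0 xy).
Qed.

(** With t strictly below the radius, some admissible r exceeds t, so z = t lies in the open disk of
    radius r; only the degree 1 term of the sum is kept there. *)
Lemma bohr_one_variable : (0 < BohrR p q N 1)%E ->
  exists2 t : R, 0 < t & forall g : 1.-tuple nat -> 'rV[R[i]]_d, bounded_holo N g ->
    N (g (Defs.mzero 1)) `^ p + (t * N (g [tuple 1%N])) `^ q <= 1.
Proof.
move=> hpos; have [t t0 tB] : exists2 t : R, 0 < t & (t%:E < BohrR p q N 1)%E.
  case: (BohrR p q N 1) hpos => [x| |//].
    by rewrite lte_fin => x0; exists (x / 2); rewrite ?lte_fin; lra.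
  by move=> _; exists 1; rewrite ?ltr01 ?ltry.
exists t => // g gb.
have : (t%:E < BohrR_f p q N g)%E.
  by apply: lt_le_trans tB _; apply: ereal_inf_lbound; exists g.
move=> /ereal_sup_gt[_ [r [r0 rP] <-]]; rewrite lte_fin => tr.
have tn : normc t%:C%C = t by rewrite normc_real gtr0_norm.
have := rP (fun=> t%:C%C) (fun i => _); rewrite tn => /(_ (fun=> tr)).
set E := (\esum_(a in _) _)%E => H.
have E1 : ((t * N (g [tuple 1%N]))%:E <= E)%E.
  have -> : t * N (g [tuple 1%N]) =
      \sum_(a <- [:: [tuple 1%N]]) N (cmonom a (fun=> t%:C%C) *: g a).
    by rewrite big_seq1 (cnormZ hN) /cmonom big_ord1 expr1 tn.
  apply: esum_ge_seq => // a; rewrite inE => /eqP -> /=.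
  by rewrite /mdeg big_ord1.
rewrite -lee_fin EFinD -poweR_EFin; apply: le_trans H.
apply: leeD => //; rewrite -poweR_EFin; apply: ler_poweR2 => //.
  by rewrite (le_trans ler01).
by rewrite lee_fin mulr_ge0 ?(cnorm_ge0 hN) // ltW.
Qed.

Lemma hom_part_bound : (0 < BohrR p q N 1)%E ->
  exists2 K : R, 0 < K & forall n (c : n.-tuple nat -> 'rV[R[i]]_d), bounded_holo N c ->
    N (c (Defs.mzero n)) `^ p <= 1 /\
    forall m z, (0 < m)%N -> in_polydisk 1 z ->
      N (hom_part c z m) <= K * (1 - N (c (Defs.mzero n)) `^ p) `^ q^-1.
Proof.
move=> /bohr_one_variable[t t0 tP]; exists t^-1; first by rewrite invr_gt0.
move=> n c cb.
have key m z : (0 < m)%N -> in_polydisk 1 z ->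
    N (c (Defs.mzero n)) `^ p + (t * N (hom_part c z m)) `^ q <= 1.
  move=> m0 z1; have := tP _ (hom_part_bounded_holo hN m0 cb z1).
  rewrite !tnth_mktuple muln0 hom_part0.
  have -> : tnth [tuple 1%N] ord0 = 1%N by [].
  by rewrite muln1.
have z0 : in_polydisk 1 (fun _ : 'I_n => 0 : R[i]) by move=> i; rewrite Normc.normc0 ltr01.
have c1 : N (c (Defs.mzero n)) `^ p <= 1.
  by apply: le_trans (key 1%N _ isT z0); rewrite lerDl powR_ge0.
split => // m z m0 z1; rewrite ler_pdivlMl //.
have q0 : 0 < q by exact: lt_le_trans ltr01 hq.
have tN : 0 <= t * N (hom_part c z m) by rewrite mulr_ge0 ?(cnorm_ge0 hN) // ltW.
have -> : t * N (hom_part c z m) = ((t * N (hom_part c z m)) `^ q) `^ q^-1.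
  by rewrite -powRrM divff ?gt_eqF // powRr1.
apply: ler_powR2; rewrite ?powR_ge0 ?invr_ge0 ?(ltW q0) //.
by rewrite lerBrDl key.
Qed.

Lemma bohr_lower (d0 : (0 < d)%N) (s : R) : (0 < BohrR p q N 1)%E -> 0 < s < 1 ->
  exists N0, forall n, (N0 <= n)%N ->
    ((s ^+ 4 * Num.sqrt (ln n%:R / n%:R))%:E <= BohrR p q N n)%E.
Proof.
move=> hpos s01; have [K K0 KP] := hom_part_bound hpos.
have [C1 C10 C1P] := cnorm_le_coord hN; have [C2 C20 C2P] := cnorm_ge_coord hN d0.
have dR : 0 < d%:R :> R by rewrite ltr0n.
(* The inverse of all constants met on the way through the d coordinates and back, so that the final
   sum is at most A itself. *)
pose e := (C1 * d%:R * (C2 * K))^-1.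
have e0 : 0 < e by rewrite invr_gt0 !mulr_gt0.
have [N0 N0P] := coef_sum_small s01 e0; exists N0 => n Nn.
set r := s ^+ 4 * _; have r0 : 0 <= r.
  by rewrite mulr_ge0 ?sqrtr_ge0 // exprn_ge0 // ltW; case/andP: s01.
apply: le_ereal_inf_tmp => _ [c cb <-]; apply: ereal_sup_ubound; exists r => //; split => // z zr.
have [c1 cP] := KP n c cb.
set A := (1 - N (c (Defs.mzero n)) `^ p) `^ q^-1 in cP.
have q0 : 0 < q by exact: lt_le_trans ltr01 hq.
have A0 : 0 <= A by exact: powR_ge0.
have Aq : A `^ q = 1 - N (c (Defs.mzero n)) `^ p.
  by rewrite -powRrM mulVf ?gt_eqF // powRr1 // subr_ge0.
suff EA : ((\esum_(a in [set a : n.-tuple nat | (0 < mdeg a)%N])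
              (N (cmonom a z *: c a))%:E) <= A%:E)%E.
  apply: (@le_trans _ _ ((N (c (Defs.mzero n)) `^ p)%:E + A%:E `^ q)%E).
    apply: leeD => //; apply: ler_poweR2 (ltW q0) _ EA.
    by apply: esum_ge0 => a _; rewrite lee_fin (cnorm_ge0 hN).
  by rewrite poweR_EFin -EFinD lee_fin Aq addrC subrK.
apply: esum_le_seq => t ut tD.
apply: (@le_trans _ _ (\sum_(a <- t) r ^+ mdeg a * N (c a))).
  apply: ler_sum => a _; rewrite (cnormZ hN) ler_wpM2r ?(cnorm_ge0 hN) //.
  by apply: normc_cmonom => i; exact: ltW.
have F0 a : 0 <= r ^+ mdeg a * N (c a) by rewrite mulr_ge0 ?exprn_ge0 // (cnorm_ge0 hN).
have [T TP] := sum_slices_ge ut tD F0; apply: le_trans TP _.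
have HB u m z' : (0 < m)%N -> (forall i, normc (z' i) < 1) ->
    normc (mpoly.meval z' (coord_mpoly c u m)) <= C2 * (K * A).
  move=> m0 z1; rewrite meval_coord_mpoly; apply: le_trans (C2P _ _) _.
  by rewrite ler_wpM2l ?(ltW C20) // cP.
apply: (@le_trans _ _ (C1 * \sum_(u < d) \sum_(m < T | (0 < m)%N) coef_l1 (coord_mpoly c u m) * r ^+ m)).
  rewrite exchange_big big_distrr /=; apply: ler_sum => m _.
  apply: (@le_trans _ _ (C1 * (r ^+ m * \sum_(u < d) \sum_(a <- slice n m) normc (c a 0 u)))).
    rewrite exchange_big /= mulrCA !big_distrr !big_seq /=; apply: ler_sum => a.
    rewrite mem_slice => /eqP ->; apply: ler_wpM2l; first by rewrite exprn_ge0.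
    exact: C1P.
  apply: ler_wpM2l; first exact: ltW.
  rewrite mulrC big_distrl /=; apply: ler_sum => u _.
  by rewrite ler_wpM2r ?exprn_ge0 //; exact: coef_l1_coord_mpoly.
apply: (@le_trans _ _ (C1 * \sum_(u < d) e * (C2 * (K * A)))).
  apply: ler_wpM2l; first exact: ltW.
  apply: ler_sum => u _; apply: (N0P n Nn (coord_mpoly c u)) => [m|m z' m0 z1].
    exact: homogeneous_coord_mpoly.
  exact: HB.
rewrite sumr_const card_ord -[X in C1 * X]mulr_natl le_eqVlt; apply/orP; left; apply/eqP.
rewrite /e; field; rewrite ?gt_eqF //.
Qed.

End BohrLowerBound.

(** * Test functions for the upper bound *)

Section BohrUpperBound.
Variables (R : realType).

Lemma onep_exp_ge (x : R) (n : nat) : 0 <= x ->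
  expR (n%:R * x / (1 + x)) <= (1 + x) ^+ n.
Proof.
move=> x0; have y0 : 0 < 1 + x by rewrite ltr_pwDl.
rewrite -mulrA expRM_natl; apply: lerXn2r; rewrite ?nnegrE ?expR_ge0 ?(ltW y0) //.
rewrite -[leRHS]invrK -[x / _]opprK expRN lef_pV2 ?posrE ?invr_gt0 ?expR_gt0 //.
apply: le_trans _ (expR_ge1Dx _).
by rewrite le_eqVlt; apply/orP; left; apply/eqP; field; rewrite gt_eqF.
Qed.

(** V >= n^rho is enough, and follows once x = rho^2 log n / n is at most rho - 1. Then sqrt V >
    (C+1) sqrt n; multiplied by sqrt V, the part C gives C sqrt(n V) and the part 1 covers the
    subtracted 1. *)
Lemma sign_weight_growth (C rho : R) : 0 < C -> 1 < rho ->
  exists N0, forall n, (N0 <= n)%N -> (0 < n)%N /\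
    let V := (1 + (rho * Num.sqrt (ln n%:R / n%:R)) ^+ 2) ^+ n in
    C * Num.sqrt (n%:R * V) < V - 1.
Proof.
move=> C0 rho1; have rho0 : 0 < rho by exact: lt_trans rho1.
have rm0 : 0 < rho - 1 by rewrite subr_gt0.
(* L >= A yields (rho - 1) L >= (C + 1)^2 and, through [ln_div_le], x <= rho - 1. *)
pose A := 1 + (C + 1) ^+ 2 / (rho - 1) + 2 * rho ^+ 2 / (rho - 1).
have t1 : 0 <= (C + 1) ^+ 2 / (rho - 1) by rewrite divr_ge0 ?sqr_ge0 // ltW.
have t2 : 0 <= 2 * rho ^+ 2 / (rho - 1) by rewrite divr_ge0 ?mulr_ge0 ?sqr_ge0 // ltW.
have [N0 N0P] := ln_nat_above A; exists N0 => n Nn.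
have /andP[n0 LA] := N0P n Nn; split => //; set L := ln n%:R in LA *; move=> V.
have L1 : 1 <= L by apply: le_trans LA; rewrite /A -addrA lerDl addr_ge0.
have L0 : 0 < L by exact: lt_le_trans L1.
have nR : 0 < n%:R :> R by rewrite ltr0n.
pose x := rho ^+ 2 * (L / n%:R).
have x0 : 0 <= x by rewrite mulr_ge0 ?sqr_ge0 // divr_ge0 // ltW.
have VE : V = (1 + x) ^+ n by rewrite /V exprMn sqr_sqrtr // divr_ge0 // ltW.
have x1 : x <= rho - 1.
  apply: (@le_trans _ _ (rho ^+ 2 * (2 / L))).
    by rewrite ler_wpM2l ?sqr_ge0 //; exact: ln_div_le.
  rewrite mulrA ler_pdivrMr // [leRHS]mulrC -ler_pdivrMr // [rho ^+ 2 * 2]mulrC.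
  by apply: le_trans LA; rewrite /A lerDr addr_ge0.
have VL : expR (rho * L) <= V.
  rewrite VE; apply: le_trans _ (onep_exp_ge n x0); rewrite ler_expR.
  have -> : n%:R * x = rho ^+ 2 * L by rewrite /x; field; rewrite gt_eqF.
  rewrite ler_pdivlMr; last by rewrite ltr_pwDl.
  rewrite expr2 -!mulrA ler_wpM2l ?(ltW rho0) // mulrC ler_wpM2r ?(ltW L0) //.
  by rewrite -lerBrDl.
have Vn : (C + 1) ^+ 2 * n%:R < V.
  apply: lt_le_trans VL; rewrite -(expR_ln_nat _ n0) -/L.
  have -> : rho * L = (rho - 1) * L + L by ring.
  rewrite expRD ltr_pM2r ?expR_gt0 //; apply: lt_le_trans _ (expR_ge1Dx _).
  apply: (@le_lt_trans _ _ ((rho - 1) * L)); last by rewrite ltrDr.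
  rewrite mulrC -ler_pdivrMr //; apply: le_trans LA.
  by rewrite /A addrAC lerDr addr_ge0.
have V0 : 0 < V by apply: lt_le_trans VL; exact: expR_gt0.
have sV : (C + 1) * Num.sqrt n%:R < Num.sqrt V.
  have -> : (C + 1) * Num.sqrt n%:R = Num.sqrt ((C + 1) ^+ 2 * n%:R).
    by rewrite sqrtrM ?sqr_ge0 // sqrtr_sqr ger0_norm // addr_ge0 // ltW.
  by rewrite ltr_sqrt.
have sn1 : 1 <= Num.sqrt n%:R :> R by rewrite -[leLHS]sqrtr1 ler_wsqrtr // ler1n.
have sV1 : 1 <= Num.sqrt V.
  apply: le_trans _ (ltW sV); rewrite -[leLHS]mulr1; apply: ler_pM => //.
  by rewrite lerDr ltW.
rewrite sqrtrM ?ltW // ltrBrDr -{2}(sqr_sqrtr (ltW V0)) expr2.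
apply: (@le_lt_trans _ _ ((C + 1) * Num.sqrt n%:R * Num.sqrt V)); last first.
  by rewrite ltr_pM2r // (lt_le_trans ltr01).
rewrite -mulrA mulrDl mul1r lerD2l -[leLHS]mulr1; exact: ler_pM.
Qed.

Variables (d : nat) (p q : R) (N : 'rV[R[i]]_d -> R).
Hypotheses (hp : 1 <= p) (hq : 1 <= q) (hN : is_cnorm N).

Definition set_tuple n (S : {ffun 'I_n -> bool}) : n.-tuple nat := [tuple (S i : nat) | i < n].

Lemma set_tuple_inj n : injective (@set_tuple n).
Proof.
move=> S1 S2 /(congr1 (fun t => tnth t)) E; apply/ffunP => i.
by have := congr1 (@^~ i) E; rewrite !tnth_mktuple; case: (S1 i); case: (S2 i).
Qed.

Lemma cmonom_set_tuple n (S : {ffun 'I_n -> bool}) (z : 'I_n -> R[i]) :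
  cmonom (set_tuple S) z = set_monom z S.
Proof.
by apply: eq_bigr => i _; rewrite tnth_mktuple; case: (S i); rewrite ?expr1.
Qed.

Definition tuple_support n (a : n.-tuple nat) : {ffun 'I_n -> bool} :=
  [ffun i => tnth a i != 0%N].

Lemma set_tupleK n : cancel (@set_tuple n) (@tuple_support n).
Proof. by move=> S; apply/ffunP => i; rewrite ffunE tnth_mktuple; case: (S i). Qed.

(** Extends a family on sets by 0 to all exponents: an exponent has entries 0 and 1 only if and only
    if it is recovered from its support. *)
Definition set_coef n (f : {ffun 'I_n -> bool} -> 'rV[R[i]]_d) (a : n.-tuple nat) : 'rV[R[i]]_d :=
  if a == set_tuple (tuple_support a) then f (tuple_support a) else 0.

Lemma set_coefE n f (S : {ffun 'I_n -> bool}) : set_coef f (set_tuple S) = f S.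
Proof. by rewrite /set_coef set_tupleK eqxx. Qed.

Lemma set_coef0 n f (a : n.-tuple nat) :
  a \notin map (@set_tuple n) (index_enum {ffun 'I_n -> bool}) -> set_coef f a = 0.
Proof.
rewrite /set_coef; case: eqP => // -> /mapP[]; exists (tuple_support a) => //.
exact: mem_index_enum.
Qed.

Lemma set_tuples_uniq n : uniq (map (@set_tuple n) (index_enum {ffun 'I_n -> bool})).
Proof. by rewrite map_inj_uniq ?index_enum_uniq //; exact: set_tuple_inj. Qed.

Lemma mdeg_set_tuple n (S : {ffun 'I_n -> bool}) : (mdeg (set_tuple S) <= n)%N.
Proof.
rewrite /mdeg -[X in (_ <= X)%N](card_ord n) -sum1_card; apply: leq_sum => i _.
by rewrite tnth_mktuple; case: (S i).
Qed.

(** Set monomials have degree at most n, so partial sums are stationary from n on and convergence is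
    immediate. *)
Lemma psum_set_coef n f (z : 'I_n -> R[i]) K : (n <= K)%N ->
  psum (set_coef f) z K = \sum_S set_monom z S *: f S.
Proof.
move=> nK.
have -> : psum (set_coef f) z K =
    \sum_(a <- box n K | (mdeg a <= K)%N) cmonom a z *: set_coef f a.
  by rewrite sum_box_slices psum_hom_part.
pose T := map (@set_tuple n) (index_enum {ffun 'I_n -> bool}).
rewrite (bigID (mem T)) /= [X in _ + X]big1 ?addr0; last first.
  by move=> a /andP[_ aT]; rewrite set_coef0 ?scaler0.
transitivity (\sum_(a <- T) cmonom a z *: set_coef f a).
  rewrite -big_filter; apply: perm_big; apply: uniq_perm.
  - by rewrite filter_uniq // box_uniq.
  - exact: set_tuples_uniq.
  - move=> a; rewrite mem_filter; apply/idP/idP => [/andP[/andP[_ ->]]//|aT].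
    rewrite aT andbT; have /mapP[S _ aS] := aT.
    have aK : (mdeg a <= K)%N by rewrite aS (leq_trans (mdeg_set_tuple S) nK).
    by rewrite aK mdeg_mem_box.
rewrite big_map; apply: eq_bigr => S _.
by rewrite cmonom_set_tuple set_coefE.
Qed.

Lemma set_coef_sum_le n f (z : 'I_n -> R[i]) (s : seq (n.-tuple nat)) : uniq s ->
  \sum_(a <- s) N (cmonom a z *: set_coef f a) <= \sum_S N (set_monom z S *: f S).
Proof.
move=> us; pose T := map (@set_tuple n) (index_enum {ffun 'I_n -> bool}).
rewrite (bigID (mem T)) /= [X in _ + X]big1 ?addr0; last first.
  by move=> a aT; rewrite set_coef0 // scaler0 (cnorm0 hN).
have -> : \sum_S N (set_monom z S *: f S) = \sum_(a <- T) N (cmonom a z *: set_coef f a).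
  by rewrite big_map; apply: eq_bigr => S _; rewrite cmonom_set_tuple set_coefE.
rewrite -big_filter; apply: ler_sum_uniq_sub.
- by rewrite filter_uniq.
- exact: set_tuples_uniq.
- by move=> a; rewrite mem_filter => /andP[].
- by move=> a; exact: (cnorm_ge0 hN).
Qed.

Lemma exists_unit_vector : (0 < d)%N -> exists v : 'rV[R[i]]_d, N v = 1.
Proof.
move=> d0; pose w : 'rV[R[i]]_d := const_mx 1.
have w0 : N w != 0.
  case: hN => h0 _ _; apply/eqP => /h0 /rowP /(_ (Ordinal d0)); rewrite !mxE => /eqP.
  by rewrite oner_eq0.
exists (((N w)^-1)%:C%C *: w).
by rewrite (cnormZ hN) normc_real ger0_norm ?mulVf // invr_ge0 (cnorm_ge0 hN).
Qed.

Lemma set_monom_scale n (k : R) (z : 'I_n -> R[i]) S :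
  set_monom (fun i => k%:C%C * z i) S = (set_weight k S)%:C%C * set_monom z S.
Proof.
rewrite /set_monom /set_weight (big_morph _ (@RtoCM R) (erefl : (1 : R)%:C%C = 1)) -big_split.
by apply: eq_bigr => i _ /=; case: (S i); rewrite ?mulr1; exact: erefl.
Qed.

Lemma set_weightM n (r k : R) (S : {ffun 'I_n -> bool}) :
  set_weight (r * k) S = set_weight r S * set_weight k S.
Proof.
by rewrite /set_weight -big_split; apply: eq_bigr => i _ /=; case: (S i); rewrite ?mulr1.
Qed.

Lemma set_weight_ge0 n (r : R) (S : {ffun 'I_n -> bool}) : 0 <= r -> 0 <= set_weight r S.
Proof. by move=> r0; apply: prodr_ge0 => i _; case: ifP. Qed.

(** The test function is P(k z) v / B with N v = 1. The sign polynomial P is bounded by B on the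
    polydisk of radius k only, and k z lies there for z in the unit polydisk; the price is the
    factor 1/k in the radius. *)
Lemma bohr_upper (d0 : (0 < d)%N) (k rho : R) : 0 < k < 1 -> 1 < rho ->
  exists N0, forall n, (N0 <= n)%N ->
    (BohrR p q N n <= (rho / k * Num.sqrt (ln n%:R / n%:R))%:E)%E.
Proof.
move=> /andP[k0 k1] rho1; have rho0 : 0 < rho by exact: lt_trans rho1.
have e0 : 0 < 1 - k by rewrite subr_gt0.
have [C C0 CP] := random_sign_poly e0.
have [N0 N0P] := sign_weight_growth C0 rho1; exists N0 => n Nn.
have [n0 /=] := N0P n Nn; set r := rho * Num.sqrt _; set V := (1 + r ^+ 2) ^+ n => CV.
have r0 : 0 <= r by rewrite mulr_ge0 ?sqrtr_ge0 // ltW.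
have V0 : 0 < V by rewrite exprn_gt0 // ltr_pwDl ?sqr_ge0.
have [s sP] := CP n n0 r r0.
pose B := C * Num.sqrt (n%:R * V).
have B0 : 0 < B by rewrite mulr_gt0 // sqrtr_gt0 mulr_gt0 // ltr0n.
have [v v1] := exists_unit_vector d0.
pose g (S : {ffun 'I_n -> bool}) : R :=
  if S != [ffun=> false] then sgnb R (s S) * set_weight r S * set_weight k S / B else 0.
pose f S := (g S)%:C%C *: v.
pose c := set_coef f.
have sumE z : \sum_S set_monom z S *: f S =
    (sign_poly s r (fun i => k%:C%C * z i) * (B^-1)%:C%C) *: v.
  rewrite /sign_poly big_distrl scaler_suml [RHS]big_mkcond /=; apply: eq_bigr => S _.
  rewrite /f /g scalerA; case: ifP => _; last by rewrite mulr0 scale0r.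
  rewrite set_monom_scale !RtoCM; congr (_ *: _); ring.
have cb : bounded_holo N c.
  split => z z1.
    apply: (@le_lt_trans _ _ (\sum_S N (set_monom z S *: f S))%:E); last exact: ltry.
    by apply: esum_le_seq => t ut _; exact: set_coef_sum_le.
  exists (\sum_S set_monom z S *: f S); split.
    apply/cvg0_nat; first by move=> K; exact: (cnorm_ge0 hN).
    move=> e ep; exists n => K nK.
    by rewrite psum_set_coef // subrr (cnorm0 hN) ltW.
  rewrite sumE (cnormZ hN) v1 mulr1 Normc.normcM normc_real ger0_norm ?invr_ge0 ?(ltW B0) //.
  rewrite ler_pdivrMr // mul1r; apply: sP => i.
  rewrite Normc.normcM normc_real ger0_norm ?(ltW k0) // subKr.
  by rewrite ler_piMr ?(ltW k0) // ltW // z1.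
apply: (@le_trans _ _ (BohrR_f p q N c)); first by apply: ereal_inf_lbound; exists c.
(* An admissible t > r/k would allow the constant point r/k. There the set S contributes r^(2|S|) /
   B, one r from the weight in P and one from k (r/k), and the total (V - 1) / B exceeds 1. *)
apply: ge_ereal_sup => _ [t [t0 tP] <-]; rewrite lee_fin leNgt; apply/negP => rt.
have kr : rho / k * Num.sqrt (ln n%:R / n%:R) = r / k by rewrite /r mulrAC.
rewrite kr in rt.
have rk0 : 0 <= r / k by rewrite divr_ge0 // ltW.
pose z : 'I_n -> R[i] := fun=> (r / k)%:C%C.
have nz i : normc (z i) = r / k by rewrite normc_real ger0_norm.
have zt : in_polydisk t z by move=> i; rewrite nz.
have := tP z zt.
set E := (\esum_(a in _) _)%E => H.
have E1 : (((V - 1) / B)%:E <= E)%E.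
  pose T := [seq set_tuple x | x <- [seq x <- index_enum {ffun 'I_n -> bool} | x != [ffun=> false]]].
  have -> : (V - 1) / B = \sum_(a <- T) N (cmonom a z *: c a).
    rewrite big_map big_filter.
    have -> : V - 1 = \sum_(S : {ffun 'I_n -> bool} | S != [ffun=> false]) set_weight (r ^+ 2) S.
      rewrite /V -sum_set_weight (bigD1 [ffun=> false]) //=.
      have -> : set_weight (r ^+ 2) ([ffun=> false] : {ffun 'I_n -> bool}) = 1.
        by rewrite /set_weight big1 // => i _; rewrite ffunE.
      by rewrite addrAC subrr add0r.
    rewrite big_distrl; apply: eq_bigr => S S0.
    rewrite cmonom_set_tuple /c set_coefE /f /g S0 scalerA (cnormZ hN) v1 mulr1.
    rewrite Normc.normcM normc_real normc_set_monom.
    have -> : \prod_(i < n) (if S i then normc (z i) else 1) = set_weight (r / k) S.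
      by apply: eq_bigr => i _; rewrite nz.
    rewrite !normrM normfV /sgnb normr_sign mul1r !ger0_norm ?set_weight_ge0 ?(ltW k0) ?(ltW B0) //.
    have -> : set_weight (r / k) S * (set_weight r S * set_weight k S / B) =
       set_weight r S * (set_weight (r / k) S * set_weight k S) / B by ring.
    by rewrite -set_weightM divfK ?gt_eqF // -expr2 set_weight_sqr.
  apply: esum_ge_seq.
    by rewrite map_inj_uniq ?filter_uniq ?index_enum_uniq //; exact: set_tuple_inj.
  move=> a /mapP[S]; rewrite mem_filter => /andP[S0 _] -> /=.
  rewrite lt0n mdeg_eq0; apply: contra S0 => /eqP E0; rewrite -[S]set_tupleK E0.
  by apply/eqP/ffunP => i; rewrite !ffunE tnth_mktuple.
have y1 : 1 < (V - 1) / B by rewrite ltr_pdivlMr // mul1r.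
have y0 : 0 <= (V - 1) / B by rewrite ltW // (lt_trans ltr01).
have q0 : 0 <= q by rewrite (le_trans ler01).
have : (((V - 1) / B)%:E `^ q <= 1)%E.
  apply: le_trans (ler_poweR2 q0 _ E1) _; first by rewrite lee_fin.
  by apply: le_trans _ H; apply: leeDr; rewrite lee_fin; exact: powR_ge0.
rewrite poweR_EFin lee_fin leNgt => /negP; apply.
exact: lt_le_trans y1 (le1r_powR (ltW y1) hq).
Qed.

End BohrUpperBound.

(** * From the two bounds to the limit *)

Theorem theorem1p3 (R : realType) (p q : R) (hp : 1 <= p) (hq : 1 <= q)
  (d : nat) (hd : (0 < d)%N) (N : 'rV[R[i]]_d -> R) (hN : is_cnorm N)
  (hpos : (0 < BohrR p q N 1)%E) :
  (fun n : nat => (BohrR p q N n * (Num.sqrt (n%:R / ln n%:R))%:E)%E)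
    @ \oo --> 1%E.
Proof.
pose X n := (BohrR p q N n * (Num.sqrt (n%:R / ln n%:R))%:E)%E.
have key (e : R) : 0 < e -> exists N0, forall n, (N0 <= n)%N ->
    ((1 - e)%:E <= X n <= (1 + e)%:E)%E.
  (* With s = k = 1 - t and rho = 1 + t, t <= 1/4 and 4t <= e yield (1 - t)^4 >= 1 - 4t >= 1 - e and
     (1 + t)/(1 - t) <= 1 + e. *)
  move=> e0; pose t := Num.min e 1 / 4.
  have m0 : 0 < Num.min e 1 by rewrite lt_min e0 ltr01.
  have t0 : 0 < t by rewrite divr_gt0.
  have te : t * 4 <= e by rewrite divfK // ge_min lexx.
  have t1 : t * 4 <= 1 by rewrite divfK // ge_min lexx orbT.
  have s01 : 0 < 1 - t < 1 by apply/andP; split; lra.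
  have rho1 : 1 < 1 + t by lra.
  have [N1 N1P] := bohr_lower hq hN hd hpos s01.
  have [N2 N2P] := bohr_upper p hq hN hd s01 rho1.
  (* Keeps log n away from 0, where n / log n takes the default value 0 and the product of the two
     square roots would not be 1. *)
  have [N3 N3P] := ln_nat_above (1 : R).
  exists (maxn N1 (maxn N2 N3)) => n; rewrite !geq_max => /and3P[n1 n2 n3].
  have /andP[n0 L1] := N3P n n3; set L := ln n%:R in L1.
  have L0 : 0 < L by exact: lt_le_trans L1.
  have nR : 0 < n%:R :> R by rewrite ltr0n.
  pose Y := Num.sqrt (n%:R / L).
  have Y0 : 0 <= Y by exact: sqrtr_ge0.
  have LY : Num.sqrt (L / n%:R) * Y = 1.
    rewrite -sqrtrM ?divr_ge0 ?(ltW L0) //.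
    have -> : L / n%:R * (n%:R / L) = 1 by field; rewrite !gt_eqF.
    exact: sqrtr1.
  have lo := N1P n n1; have up := N2P n n2; rewrite -/L in lo up.
  have Y0e : (0%:E <= Y%:E)%E by rewrite lee_fin.
  apply/andP; split.
    apply: le_trans (lee_wpmul2r Y0e lo); rewrite -EFinM lee_fin -mulrA LY mulr1.
    have q1 : 1 - 2 * t <= (1 - t) ^+ 2.
      rewrite -subr_ge0; have -> : (1 - t) ^+ 2 - (1 - 2 * t) = t ^+ 2 by ring.
      exact: sqr_ge0.
    have -> : (1 - t) ^+ 4 = ((1 - t) ^+ 2) ^+ 2 by rewrite -exprM.
    apply: (@le_trans _ _ ((1 - 2 * t) ^+ 2)).
      have -> : (1 - 2 * t) ^+ 2 = 1 - 4 * t + (2 * t) ^+ 2 by ring.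
      have := sqr_ge0 (2 * t); lra.
    by apply: lerXn2r => //; rewrite nnegrE; lra.
  apply: le_trans (lee_wpmul2r Y0e up) _; rewrite -EFinM lee_fin.
  rewrite -[leLHS]mulrA LY mulr1.
  rewrite ler_pdivrMr; last by lra.
  have -> : (1 + e) * (1 - t) = 1 + e - t - e * t by ring.
  have : t * e <= e / 4 by rewrite [leRHS]mulrC ler_wpM2r ?(ltW e0) //; lra.
  rewrite [t * e]mulrC; lra.
(* The sequence has extended real values; the bounds with e = 1 show that they are eventually
   finite. *)
apply/fine_cvgP; split.
  have [N0 N0P] := key 1 ltr01; exists N0 => // n /= Nn.
  have /andP[h1 h2] := N0P n Nn.
  by rewrite fin_numE; apply/andP; split; apply/eqP => E; move: h1 h2; rewrite -/(X n) in E; rewrite E.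
apply/cvgrPdist_le => e e0; have [N0 N0P] := key e e0; exists N0 => // n /= Nn.
have := N0P n Nn; rewrite -/(X n).
case: (X n) => [x| |] /andP[h1 h2]; last 2 first.
- by move: h2; rewrite leye_eq.
- by move: h1; rewrite leeNy_eq.
rewrite /= ler_norml; move: h1 h2; rewrite !lee_fin => h1 h2.
by apply/andP; split; lra.
Qed.
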